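(* Let $n\ge 1$, and suppose that to every non-degenerate simplex $\Delta=(V_0,\dots,V_n)$ in $\mathbb{R}^n$ a point $C(\Delta)\in\mathbb{R}^n$ is assigned so that the following hold: 1. the map $\Delta\mapsto C(\Delta)$ commutes with all similarities of $\mathbb{R}^n$ (both orientation-preserving and orientation-reversing), i.e. $C(g\Delta)=g(C(\Delta))$ for every similarity $g$; 2. $C(\Delta)$ is invariant under permutations of the vertices of $\Delta$; 3. the map $\Delta\mapsto \mathrm{Vol}(\Delta)\,C(\Delta)$, where $\mathrm{Vol}(\Delta)$ is the oriented volume, is polynomial in the coordinates of the vertices of $\Delta$. Then there is a constant $t\in\mathbb{R}$, depending on the map $C$ but not on the simplex, such that for every non-degenerate simplex $\Delta\subset\mathbb{R}^n$ $$C(\Delta)=t\,CM(\Delta)+(1-t)\,CC(\Delta).$$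
   Context: A non-degenerate simplex $\Delta=(V_0,\dots,V_n)$ in $\mathbb{R}^n$ is an (ordered) $(n+1)$-tuple of affinely independent points (its vertices). Its oriented volume $\mathrm{Vol}(\Delta)$ is, up to a fixed nonzero constant factor depending only on $n$, the determinant of the $(n+1)\times(n+1)$ matrix whose $j$-th column ($j=0,\dots,n$) consists of the coordinates of $V_j$ followed by $1$. $CM(\Delta)=\frac{1}{n+1}\sum_{j=0}^n V_j$ is the center of mass (centroid). $CC(\Delta)$ is the circumcenter, i.e. the unique point equidistant from $V_0,\dots,V_n$. A similarity is a map $x\mapsto \lambda Rx+b$ with $\lambda>0$, $R\in O(n)$, $b\in\mathbb{R}^n$; it acts on simplices by acting on each vertex. Condition 3 means that each coordinate of $\mathrm{Vol}(\Delta)C(\Delta)$ agrees, on non-degenerate simplices, with a real polynomial in the $n(n+1)$ coordinates of the vertices. *)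

(* Defs.v *)
From mathcomp Require Import all_boot all_order all_fingroup all_algebra.
From mathcomp Require Import boolp classical_sets reals.
From mathcomp Require Import lra.
From mathcomp Require Export mpoly.

Set Implicit Arguments.
Unset Strict Implicit.
Unset Printing Implicit Defensive.

Import Order.TTheory GRing.Theory Num.Theory.
Local Open Scope ring_scope.

(* An ordered (n+1)-tuple of points of R^n, stored as the n x (n+1) matrix
   whose j-th column is the vertex V_j; it may be degenerate. *)
Definition simplex (R : realType) (n : nat) : Type := 'M[R]_(n, n + 1).

Section Simplices.
Variables (R : realType) (n : nat).
Implicit Types (V : simplex R n) (x y : 'cV[R]_n).

Definition vertex V (j : 'I_(n + 1)) : 'cV[R]_n := col j V.

(* Non-degenerate means that the vertices are affinely independent. *)
Definition nondegenerate_simplex V : Prop :=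
  forall a : 'I_(n + 1) -> R,
    \sum_j a j = 0 -> \sum_j a j *: vertex V j = 0 -> forall j, a j = 0.

Definition Vol V : R :=
  (n`!%:R)^-1 * \det (col_mx V (const_mx 1 : 'rV[R]_(n + 1))).

Definition CM V : 'cV[R]_n := (n + 1)%:R^-1 *: \sum_j vertex V j.

(* The library norm on matrices is the sup norm, hence the explicit formula
   for the Euclidean distance. *)
Definition dist x y : R := Num.sqrt (\sum_i (x i 0 - y i 0) ^+ 2).

Definition equidistant V x : Prop :=
  forall i j, dist x (vertex V i) = dist x (vertex V j).

(* The point equidistant from the vertices; by [equidistant_CC] and
   [equidistant_unique] it is well defined when V is non-degenerate.  The
   default value 0 is only relevant to degenerate V. *)
Definition CC V : 'cV[R]_n := xget 0 [set x | equidistant V x]%classic.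

Definition is_similarity (g : 'cV[R]_n -> 'cV[R]_n) : Prop :=
  exists (lambda : R) (Q : 'M[R]_n) (b : 'cV[R]_n),
    [/\ 0 < lambda, Q^T *m Q = 1%:M & forall x, g x = lambda *: (Q *m x) + b].

Definition act_simplex (g : 'cV[R]_n -> 'cV[R]_n) V : simplex R n :=
  \matrix_(i, j) g (vertex V j) i 0.

Definition permute_simplex (s : 'S_(n + 1)) V : simplex R n :=
  \matrix_(i, j) V i (s j).

(* The n(n+1) coordinates of the vertices are flattened by [mxvec], so that
   they can be substituted for the variables of a polynomial. *)
Definition coords V : 'I_(n * (n + 1)) -> R := fun k => mxvec V 0 k.

Definition polynomial_on_nondegenerate (F : simplex R n -> 'cV[R]_n) : Prop :=
  forall i : 'I_n, exists p : {mpoly R[n * (n + 1)]},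
    forall V, nondegenerate_simplex V -> F V i 0 = p.@[coords V].

Let aug V : 'M[R]_(n + 1) := col_mx V (const_mx 1 : 'rV[R]_(n + 1)).

Lemma aug_unit V : nondegenerate_simplex V -> aug V \in unitmx.
Proof.
move=> nd; rewrite -unitmx_tr -row_free_unit; apply: inj_row_free => v.
move/(congr1 trmx); rewrite trmx_mul trmxK trmx0 mul_col_mx -col_mx0.
case/eq_col_mx => hV h1; apply/rowP => j; rewrite [RHS]mxE.
apply: (nd (fun j => v 0 j)).
  transitivity ((const_mx 1 *m v^T : 'M[R]_1) 0 0); last by rewrite h1 mxE.
  by rewrite mxE; apply: eq_bigr => k _; rewrite !mxE mul1r.
apply/colP => i; transitivity ((V *m v^T) i 0); last by rewrite hV !mxE.
rewrite mxE summxE; apply: eq_bigr => k _.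
by rewrite !mxE mulrC.
Qed.

Lemma mul_aug V (u : 'rV[R]_n) (d : R) j :
  (row_mx u d%:M *m aug V) 0 j = \sum_i u 0 i * V i j + d.
Proof.
rewrite mul_row_col mxE; congr (_ + _); first by rewrite mxE.
by rewrite mul_scalar_mx !mxE mulr1.
Qed.

Lemma sqdistE V x j :
  \sum_i (x i 0 - vertex V j i 0) ^+ 2 =
  \sum_i x i 0 ^+ 2 + \sum_i V i j ^+ 2 - \sum_i (x i 0 *+ 2) * V i j.
Proof.
rewrite -sumrN -!big_split /=; apply: eq_bigr => i _.
by rewrite mxE sqrrB mulrnAl addrAC.
Qed.

Lemma equidistant_sq V x : equidistant V x -> forall i j,
  \sum_k (x k 0 - vertex V i k 0) ^+ 2 = \sum_k (x k 0 - vertex V j k 0) ^+ 2.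
Proof.
move=> h i j; have ge0 l : 0 <= \sum_k (x k 0 - vertex V l k 0) ^+ 2.
  by apply: sumr_ge0 => k _; apply: sqr_ge0.
by rewrite -[LHS]sqr_sqrtr // -[RHS]sqr_sqrtr //; congr (_ ^+ 2); apply: h.
Qed.

Lemma equidistant_CC V : nondegenerate_simplex V -> equidistant V (CC V).
Proof.
move=> /aug_unit uV; rewrite /CC; case: xgetP => [x _ //|none]; exfalso.
pose r : 'rV[R]_(n + 1) := \row_j \sum_i V i j ^+ 2.
pose w := r *m invmx (aug V).
pose x : 'cV[R]_n := 2%:R^-1 *: (lsubmx w)^T.
apply: (none x) => j k; rewrite /dist !sqdistE; congr Num.sqrt.
have key l : \sum_i (x i 0 *+ 2) * V i l + rsubmx w 0 0 = \sum_i V i l ^+ 2.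
  have <- : r 0 l = \sum_i V i l ^+ 2 by rewrite mxE.
  rewrite -(mulmxKV uV r) -/w -[in RHS](hsubmxK w).
  rewrite [in RHS](mx11_scalar (rsubmx w)) mul_aug; congr (_ + _); apply: eq_bigr => i _; congr (_ * _).
  have -> : x i 0 = 2%:R^-1 * lsubmx w 0 i by rewrite mxE [X in _ * X]mxE.
  by rewrite -[LHS]mulr_natl mulVKf ?pnatr_eq0.
rewrite -!key -!addrA; congr (_ + _).
by rewrite [LHS]addrC subrK [RHS]addrC subrK.
Qed.

Lemma equidistant_unique V x y :
  nondegenerate_simplex V -> equidistant V x -> equidistant V y -> x = y.
Proof.
move=> /aug_unit uV /equidistant_sq hx /equidistant_sq hy.
pose j0 : 'I_(n + 1) := rshift n 0.
pose f j := \sum_i ((x - y) i 0 *+ 2) * V i j.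
have fE j : f j = \sum_i (x i 0 *+ 2) * V i j - \sum_i (y i 0 *+ 2) * V i j.
  rewrite -sumrN -big_split; apply: eq_bigr => i _ /=.
  by rewrite !mxE mulrnBl mulrBl.
have fc j : f j = f j0.
  have := hx j j0; have := hy j j0; rewrite !sqdistE !fE.
  set a := \sum_i x i 0 ^+ 2; set b := \sum_i y i 0 ^+ 2.
  set c := \sum_i V i j ^+ 2; set d := \sum_i V i j0 ^+ 2.
  set p := \sum_i (x i 0 *+ 2) * V i j; set p0 := \sum_i (x i 0 *+ 2) * V i j0.
  set q := \sum_i (y i 0 *+ 2) * V i j; set q0 := \sum_i (y i 0 *+ 2) * V i j0.
  by move=> hyj hxj; lra.
have /eqP : row_mx (2%:R *: (x - y))^T (- f j0)%:M = 0 :> 'rV[R]_(n + 1).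
  apply: (can_inj (mulmxK uV)); rewrite mul0mx; apply/rowP => j.
  rewrite mul_aug mxE -[X in _ - X](fc j); apply/eqP; rewrite subr_eq0; apply/eqP.
  by apply: eq_bigr => i _; rewrite 2!mxE mulr_natl.
rewrite row_mx_eq0 => /andP[/eqP/(congr1 trmx)]; rewrite trmxK trmx0 => /eqP.
by rewrite scaler_eq0 pnatr_eq0 subr_eq0 => /eqP.
Qed.

End Simplices.

(* Main.v *)
(* Put one vertex at the origin and let M be the matrix of the others; then
   G(M) = det(M) C(M) is polynomial, homogeneous of degree n + 1, alternating in the
   columns of M, and satisfies G(QM) = det(Q) Q G(M) for Q orthogonal.  Exchanging
   the origin with a vertex shows that G vanishes when a column does, so every
   column occurs in every monomial and G is a sum of parts F_i, quadratic in the
   column i and linear in the others.  Evaluating F_i on distinct basis vectors,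
   with sign changes and a rational reflection, shows that G is determined by two
   scalars, gamma and beta.  The centroid and the circumcenter, relative to
   the origin, realize independent values of these, so C is a combination of the
   two; moving the origin to another vertex forces the coefficients to add up to 1. *)
Require Import Defs.
From mathcomp Require Import all_boot all_order all_fingroup all_algebra.
From mathcomp Require Import boolp classical_sets reals.
From mathcomp Require Import ring lra.
Import Order.TTheory GRing.Theory Num.Theory.
Local Open Scope ring_scope.

Set Implicit Arguments.
Unset Strict Implicit.
Unset Printing Implicit Defensive.

(** * Polynomial functions and their restrictions to lines *)

Section PolynomialFunctions.
Variable R : realFieldType.

(** Polynomial functions of the coordinates [x i], given by closure rules instead of coefficients:
    substitution and division by a variable then go by induction. *)
Inductive polyfun (T I : Type) (x : I -> T -> R) : (T -> R) -> Prop :=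
| polyfun_cst a : polyfun x (fun=> a)
| polyfun_coord i : polyfun x (x i)
| polyfun_add f g : polyfun x f -> polyfun x g -> polyfun x (fun t => f t + g t)
| polyfun_mul f g : polyfun x f -> polyfun x g -> polyfun x (fun t => f t * g t).

Section Closure.
Variables (T I : Type) (x : I -> T -> R).

Lemma eq_polyfun f g : f =1 g -> polyfun x f -> polyfun x g.
Proof. by move=> /funext ->. Qed.

Lemma polyfun_sum (J : Type) (r : seq J) (P : pred J) (F : J -> T -> R) :
  (forall j, polyfun x (F j)) -> polyfun x (fun t => \sum_(j <- r | P j) F j t).
Proof.
move=> pF; elim: r => [|j r IHr].
  by apply: eq_polyfun (polyfun_cst x 0) => t; rewrite big_nil.
case Pj: (P j); last by apply: eq_polyfun IHr => t; rewrite big_cons Pj.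
by apply: eq_polyfun (polyfun_add (pF j) IHr) => t; rewrite big_cons Pj.
Qed.

Lemma polyfun_prod (J : Type) (r : seq J) (P : pred J) (F : J -> T -> R) :
  (forall j, polyfun x (F j)) -> polyfun x (fun t => \prod_(j <- r | P j) F j t).
Proof.
move=> pF; elim: r => [|j r IHr].
  by apply: eq_polyfun (polyfun_cst x 1) => t; rewrite big_nil.
case Pj: (P j); last by apply: eq_polyfun IHr => t; rewrite big_cons Pj.
by apply: eq_polyfun (polyfun_mul (pF j) IHr) => t; rewrite big_cons Pj.
Qed.

Lemma polyfun_exp f k : polyfun x f -> polyfun x (fun t => f t ^+ k).
Proof.
move=> pf; elim: k => [|k IHk]; first exact: eq_polyfun (polyfun_cst x 1).
by apply: eq_polyfun (polyfun_mul pf IHk) => t; rewrite exprS.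
Qed.

Lemma polyfun_meval m (p : {mpoly R[m]}) (y : 'I_m -> T -> R) :
  (forall k, polyfun x (y k)) -> polyfun x (fun t => p.@[fun k => y k t]).
Proof.
move=> py; pose f t := \sum_(u <- msupp p) p@_u * \prod_k y k t ^+ u k.
apply: (@eq_polyfun f); first by move=> t; rewrite mevalE.
apply: polyfun_sum => u; apply: polyfun_mul; first exact: polyfun_cst.
by apply: polyfun_prod => k; apply: polyfun_exp.
Qed.

Lemma polyfun_det n (A : T -> 'M[R]_n) :
  (forall i j, polyfun x (fun t => A t i j)) -> polyfun x (fun t => \det (A t)).
Proof.
move=> pA; apply: polyfun_sum => s; apply: polyfun_mul; first exact: polyfun_cst.
exact: polyfun_prod.
Qed.

Lemma polyfun_adj n (A : T -> 'M[R]_n) i j :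
  (forall k l, polyfun x (fun t => A t k l)) ->
  polyfun x (fun t => (\adj (A t)) i j).
Proof.
move=> pA; pose f t := cofactor (A t) j i.
apply: (@eq_polyfun f); first by move=> t; rewrite mxE.
apply: polyfun_mul; first exact: polyfun_cst.
apply: polyfun_det => k l.
by apply: eq_polyfun (pA (lift j k) (lift i l)) => t; rewrite !mxE.
Qed.

End Closure.

Lemma polyfun_comp T I T' I' (x : I -> T -> R) (y : I' -> T' -> R)
    (h : T' -> T) f :
  (forall i, polyfun y (fun t => x i (h t))) -> polyfun x f ->
  polyfun y (fun t => f (h t)).
Proof.
move=> px; elim=> {f} [a|i|f g _ pf _ pg|f g _ pf _ pg] //.
- exact: polyfun_cst.
- exact: polyfun_add.
- exact: polyfun_mul.
Qed.

Definition mxcoord m n (ij : 'I_m * 'I_n) (A : 'M[R]_(m, n)) := A ij.1 ij.2.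

Lemma polyfun_entry m n i j : polyfun (@mxcoord m n) (fun A => A i j).
Proof. exact: (polyfun_coord (@mxcoord m n) (i, j)). Qed.

Lemma poly_eq0_horner (p : {poly R}) : (forall s, p.[s] = 0) -> p = 0.
Proof.
move=> p0; apply: (@roots_geq_poly_eq0 _ p [seq i%:R | i <- iota 0 (size p)]).
- by apply/allP => s _; apply/eqP/p0.
- rewrite map_inj_uniq ?iota_uniq // => i j /eqP.
  by rewrite eqr_nat => /eqP.
- by rewrite size_map size_iota.
Qed.

(** Polynomiality along lines makes sense without coordinates, and reduces density and degree
    arguments to polynomials in one variable. *)
Definition linepoly (E : lmodType R) (q : E -> R) :=
  forall x y, exists r : {poly R}, forall s, q (x + s *: y) = r.[s].

Lemma polyfun_linepoly m n (f : 'M[R]_(m, n) -> R) :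
  polyfun (@mxcoord m n) f -> linepoly f.
Proof.
elim=> {f} [a|[i j]|f g _ pf _ pg|f g _ pf _ pg] x y.
- by exists a%:P => s; rewrite hornerC.
- exists ((x i j)%:P + y i j *: 'X) => s.
  by rewrite /mxcoord !mxE hornerD hornerC hornerZ hornerX mulrC.
- have [[r rE] [r' rE']] := (pf x y, pg x y).
  by exists (r + r') => s; rewrite hornerD -rE -rE'.
- have [[r rE] [r' rE']] := (pf x y, pg x y).
  by exists (r * r') => s; rewrite hornerM -rE -rE'.
Qed.

Section Lines.
Variable E : lmodType R.
Implicit Types (q : E -> R) (x y : E).

Lemma linepolyD q q' : linepoly q -> linepoly q' -> linepoly (fun x => q x + q' x).
Proof.
move=> lq lq' x y; have [[r rE] [r' rE']] := (lq x y, lq' x y).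
by exists (r + r') => s; rewrite hornerD -rE -rE'.
Qed.

Lemma linepolyZ a q : linepoly q -> linepoly (fun x => a * q x).
Proof.
move=> lq x y; have [r rE] := lq x y.
by exists (a *: r) => s; rewrite hornerZ -rE.
Qed.

Lemma linepoly_affine (E' : lmodType R) (h : E' -> E) q :
  (forall a b : E', exists u, forall s, h (a + s *: b) = h a + s *: u) ->
  linepoly q -> linepoly (fun a => q (h a)).
Proof.
move=> hh lq a b; have [u uE] := hh a b; have [r rE] := lq (h a) u.
by exists r => s; rewrite uE rE.
Qed.

(** A density argument: [d] times the restriction of [q] to the line vanishes at every point, so it
    is the zero polynomial, and [d] cancels. *)
Lemma linepoly_eq0_off q (d : {poly R}) x y :
  linepoly q -> d != 0 -> (forall s, d.[s] != 0 -> q (x + s *: y) = 0) ->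
  q x = 0.
Proof.
move=> lq d0 q0; have [r rE] := lq x y.
have /eqP : d * r = 0.
  apply: poly_eq0_horner => s; rewrite hornerM -rE.
  by have [-> | /q0 ->] := eqVneq d.[s] 0; rewrite ?mul0r ?mulr0.
rewrite mulf_eq0 (negPf d0) => /= /eqP r0.
by have := rE 0; rewrite scale0r addr0 r0 horner0.
Qed.

(** With [w] the reversal of [r'], the relation becomes [r * 'X^k = 'X^d * w], where [w] has degree
    at most [k]; comparing sizes bounds the degree of [r] by [d]. *)
Lemma size_reversed (r r' : {poly R}) d :
  (forall s, s != 0 -> r.[s] = s ^+ d * r'.[s^-1]) -> (size r <= d.+1)%N.
Proof.
move=> rr'; pose k := size r'.
pose w : {poly R} := \poly_(i < k.+1) r'`_(k - i).
have wE s : s != 0 -> w.[s] = s ^+ k * r'.[s^-1].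
  move=> s0; rewrite horner_poly (@horner_coef_wide _ k.+1 r') ?leqnSn //.
  rewrite (reindex_inj rev_ord_inj) mulr_sumr; apply: eq_bigr => i _ /=.
  rewrite subSS subKn -1?ltnS //.
  rewrite mulrCA; congr (_ * _); rewrite exprVn.
  have le_ik : (i <= k)%N by rewrite -ltnS.
  have -> : s ^+ k = s ^+ (k - i) * s ^+ i by rewrite -exprD subnK.
  by rewrite mulfK // expf_neq0.
(* The factor ['X] settles the point 0, where the relation through [s^-1] says nothing. *)
have /eqP : 'X * (r * 'X^k - 'X^d * w) = 0.
  apply: poly_eq0_horner => s; rewrite !hornerE.
  have [-> | s0] := eqVneq s 0; first by rewrite mul0r.
  by rewrite rr' // wE //; ring.
rewrite mulf_eq0 polyX_eq0 /= subr_eq0 => /eqP rw.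
have [-> | r0] := eqVneq r 0; first by rewrite size_poly0.
have := congr1 (fun p : {poly R} => size p) rw; rewrite /= size_mulXn //.
have : (size ('X^d * w)%R <= d + k.+1)%N.
  apply: leq_trans (size_polyMleq _ _) _.
  by rewrite size_polyXn /= leq_add2l size_poly.
by move=> le_dk rk; move: le_dk; rewrite -rk addnC addnS -addSn leq_add2r.
Qed.

(** By homogeneity, [q (x + s *: y)] is [s ^+ d] times [q (y + s^-1 *: x)], so [size_reversed]
    applies. *)
Lemma linepoly_reversed q d x y : linepoly q ->
  (forall s x, s != 0 -> q (s *: x) = s ^+ d * q x) ->
  exists2 r : {poly R}, (size r <= d.+1)%N & forall s, q (x + s *: y) = r.[s].
Proof.
move=> lq hq; have [[r rE] [r' rE']] := (lq x y, lq y x).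
exists r => //; apply: (@size_reversed r r') => s s0.
by rewrite -rE -rE' -hq // scalerDr scalerA mulfV // scale1r addrC.
Qed.

(** Both restrictions have degree at most 1, and each is the reversal of the other: the coefficients
    of [r] are [q x] and [q y], and its value at 1 is their sum. *)
Lemma linepoly_additive q : linepoly q ->
  (forall s x, s != 0 -> q (s *: x) = s * q x) ->
  forall x y, q (x + y) = q x + q y.
Proof.
move=> lq hq x y.
have hq1 s z : s != 0 -> q (s *: z) = s ^+ 1 * q z by rewrite expr1; apply: hq.
have [r /(@horner_coef_wide _ 2) rw rE] := linepoly_reversed x y lq hq1.
have [r' /(@horner_coef_wide _ 2) rw' rE'] := linepoly_reversed y x lq hq1.
have e s : s != 0 -> r.[s] = s * r'.[s^-1].
  move=> s0; rewrite -rE -rE' -hq //.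
  by rewrite scalerDr scalerA mulfV // scale1r addrC.
have := e 1 (oner_neq0 _); have := e 2%:R; rewrite pnatr_eq0 => /(_ isT).
have := rE 0; have := rE' 0; have := rE 1.
rewrite !rw !rw' !big_ord_recl !big_ord0 /= !scale0r !addr0 scale1r invr1.
rewrite !expr0 !expr1 !mulr1 !mulr0 !addr0.
by move=> -> -> ->; lra.
Qed.

Lemma linepoly_quadratic q : linepoly q ->
  (forall s x, s != 0 -> q (s *: x) = s ^+ 2 * q x) ->
  forall x y s, q (x + s *: y) = q x + s * (q (x + y) - q x - q y) + s ^+ 2 * q y.
Proof.
move=> lq hq x y s.
have [r /(@horner_coef_wide _ 3) rw rE] := linepoly_reversed x y lq hq.
have [r' /(@horner_coef_wide _ 3) rw' rE'] := linepoly_reversed y x lq hq.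
have e a : a != 0 -> r.[a] = a ^+ 2 * r'.[a^-1].
  move=> a0; rewrite -rE -rE' -hq //.
  by rewrite scalerDr scalerA mulfV // scale1r addrC.
have := e 1 (oner_neq0 _); have := e (-1); rewrite oppr_eq0 oner_eq0 => /(_ isT).
have := e 2%:R; rewrite pnatr_eq0 => /(_ isT).
rewrite rE; have := rE 0; have := rE' 0; have := rE 1.
rewrite !rw !rw' !big_ord_recl !big_ord0 /= !scale0r !addr0 scale1r invrN invr1.
rewrite /bump /= !add1n !expr0 !expr1 !mulr1 !mulr0 !expr0n /= !mulr0 !addr0.
set a := r`_0; set b := r`_1; set c := r`_2.
set a' := r'`_0; set b' := r'`_1; set c' := r'`_2.
move=> -> -> -> e2 eN1 e1.
(* The relation at 1, -1 and 2 identifies [r] with the reversal of [r'], both of degree at most 2;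
   so the leading coefficient of [r] is [q y]. *)
have -> : c = a' by move: e2 eN1 e1; lra.
by ring.
Qed.

Lemma additive_expand q (J : finType) (a : J -> R) (e : J -> E) :
  (forall s x, s != 0 -> q (s *: x) = s * q x) ->
  (forall x y, q (x + y) = q x + q y) ->
  q (\sum_j a j *: e j) = \sum_j a j * q (e j).
Proof.
move=> hq aq; have q0 : q 0 = 0.
  by have := aq 0 0; rewrite addr0 => /eqP; rewrite addrC -subr_eq subrr => /eqP.
elim/big_rec2: _ => // j y z _ <-; rewrite aq; congr (_ + _).
by have [-> | /hq //] := eqVneq (a j) 0; rewrite scale0r mul0r.
Qed.

End Lines.
End PolynomialFunctions.

(** * Density of the invertible matrices, and homogeneous functions divisible by all variables *)

Section Homogeneity.
Variables (R : realFieldType) (n : nat).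

(** On the line [M + s *: 1%:M], singular matrices occur only at the roots of the monic polynomial
    [char_poly (- M)]. *)
Lemma linepoly_eq_unitmx (f g : 'M[R]_n -> R) : linepoly f -> linepoly g ->
  {in unitmx, f =1 g} -> f =1 g.
Proof.
move=> lf lg fg M; apply/eqP; rewrite -subr_eq0; apply/eqP.
rewrite -mulN1r.
apply: (@linepoly_eq0_off _ _ (fun M => f M + (-1) * g M) (char_poly (- M)) M 1%:M).
- by apply: linepolyD => //; apply: linepolyZ.
- by rewrite monic_neq0 // char_poly_monic.
move=> s hs; rewrite fg ?mulN1r ?subrr // unitmxE unitfE; apply: contraNneq hs.
rewrite /char_poly -[_.[s]]/(horner_eval s _) -det_map_mx => <-.
apply/eqP; congr (\det _); apply/matrixP => i j.
by rewrite !mxE /= /horner_eval !hornerE hornerMn hornerX mulr_natr opprK addrC.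
Qed.

Definition zero_at (i : 'I_n) (s : 'rV[R]_n) : 'rV[R]_n :=
  \row_j (if j == i then 0 else s 0 j).

Lemma polyfun_divide (f : 'rV[R]_n -> R) i : polyfun (@mxcoord R 1 n) f ->
  exists2 g, polyfun (@mxcoord R 1 n) g
           & forall s, f s = s 0 i * g s + f (zero_at i s).
Proof.
elim=> {f} [a|[z j]|f f' pf [g pg gE] pf' [g' pg' gE']|f f' pf [g pg gE] pf' [g' pg' gE']].
- by exists (fun=> 0); [exact: polyfun_cst | move=> s; rewrite mulr0 add0r].
- rewrite /mxcoord (ord1 z) /=; exists (fun=> (j == i)%:R); first exact: polyfun_cst.
  move=> s; rewrite mxE; case: eqP => [->|_]; first by rewrite mulr1 addr0.
  by rewrite mulr0 add0r.
- exists (fun s => g s + g' s); first exact: polyfun_add.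
  by move=> s; rewrite gE gE'; ring.
have pz (h : 'rV[R]_n -> R) : polyfun (@mxcoord R 1 n) h ->
    polyfun (@mxcoord R 1 n) (fun s => h (zero_at i s)).
  apply: polyfun_comp => -[z j]; rewrite /mxcoord (ord1 z) /=.
  case: (eqVneq j i) => [->|ji].
    by apply: eq_polyfun (polyfun_cst _ 0) => s; rewrite mxE eqxx.
  by apply: eq_polyfun (polyfun_entry R ord0 j) => s; rewrite mxE (negPf ji).
(* Divide [f] first, then divide the factor [f'] that multiplies its remainder. *)
exists (fun s => g s * f' s + f (zero_at i s) * g' s).
  by apply: polyfun_add; apply: polyfun_mul => //; apply: pz.
by move=> s; rewrite [f s in LHS]gE [in LHS]gE' [f' s in RHS]gE'; ring.
Qed.

(** The variables are divided out one at a time; the induction keeps track of the fact that the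
    quotient still vanishes on the hyperplanes of the remaining variables. *)
Lemma polyfun_divide_prod (f : 'rV[R]_n -> R) : polyfun (@mxcoord R 1 n) f ->
  (forall (i : 'I_n) (s : 'rV[R]_n), s 0 i = 0 -> f s = 0) ->
  exists2 g, polyfun (@mxcoord R 1 n) g & forall s : 'rV[R]_n, f s = \prod_i s 0 i * g s.
Proof.
move=> pf f0.
suff: forall r : seq 'I_n, uniq r -> exists g, [/\ polyfun (@mxcoord R 1 n) g,
    forall s : 'rV[R]_n, f s = \prod_(i <- r) s 0 i * g s &
    forall (i : 'I_n) (s : 'rV[R]_n), i \notin r -> s 0 i = 0 -> g s = 0].
  by case/(_ (index_enum _) (index_enum_uniq _)) => g [pg gE _]; exists g.
elim=> [_|i r IHr /= /andP[ir /IHr[g [pg gE g0]]]].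
  by exists f; split=> // [s|i s _ /f0 //]; rewrite big_nil mul1r.
have [g' pg' gE'] := polyfun_divide i pg.
have {}gE' s : g s = s 0 i * g' s.
  by rewrite gE' [g (zero_at _ _)](g0 i) ?addr0 // mxE eqxx.
exists g'; split=> // [s|j s]; first by rewrite gE gE' big_cons; ring.
rewrite inE negb_or => /andP[ji jr] sj.
(* Moving along the variable [i] stays in the hyperplane of [j] and makes the divisor [s 0 i]
   nonzero, except at one parameter. *)
apply: (@linepoly_eq0_off _ _ g' ((s 0 i)%:P + 'X) s (delta_mx 0 i)).
- exact: polyfun_linepoly.
- by apply/eqP => /(congr1 (coefp 1)) /eqP; rewrite /= !coefE add0r oner_eq0.
move=> a; rewrite !hornerE => sa; set x := s + _.
have xi : x 0 i = s 0 i + a by rewrite !mxE !eqxx mulr1.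
have xj : x 0 j = 0 by rewrite !mxE eqxx (negPf ji) mulr0 addr0.
by move/eqP: (gE' x); rewrite (g0 j) // xi eq_sym mulf_eq0 (negPf sa) => /eqP.
Qed.

(** The quotient of [f] by the product of the variables is homogeneous of degree 1 where that
    product is nonzero, hence everywhere by density, hence linear. *)
Lemma polyfun_prod_linear (f : 'rV[R]_n -> R) : polyfun (@mxcoord R 1 n) f ->
  (forall (i : 'I_n) (s : 'rV[R]_n), s 0 i = 0 -> f s = 0) ->
  (forall a (s : 'rV[R]_n), a != 0 -> f (a *: s) = a ^+ n.+1 * f s) ->
  exists a : 'I_n -> R, forall s : 'rV[R]_n, f s = \prod_i s 0 i * \sum_i s 0 i * a i.
Proof.
move=> pf f0 fh; have [g pg gE] := polyfun_divide_prod pf f0.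
have lg := polyfun_linepoly pg.
have gh a s : a != 0 -> g (a *: s) = a * g s.
  move=> a0; apply/eqP; rewrite -subr_eq0 -mulNr; apply/eqP.
  apply: (@linepoly_eq0_off _ _ (fun s => g (a *: s) + - a * g s)
            (\prod_i ((s 0 i)%:P + 'X)) s (const_mx 1)).
  - apply: linepolyD; last exact: linepolyZ.
    apply: linepoly_affine lg => x y; exists (a *: y) => b.
    by rewrite scalerDr !scalerA mulrC.
  - apply/prodf_neq0 => i _; apply/eqP => /(congr1 (coefp 1)) /eqP.
    by rewrite /= !coefE add0r oner_eq0.
  move=> b; set x := s + _; rewrite horner_prod => sb.
  have := fh a x a0; rewrite !gE.
  under eq_bigr do rewrite mxE.
  rewrite big_split /= prodr_const card_ord exprSr.
  have px : \prod_i x 0 i != 0.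
    apply: contraNneq sb => <-; apply/eqP/eq_bigr => i _.
    by rewrite !hornerE !mxE mulr1.
  move=> e; apply: (@mulfI _ (a ^+ n * \prod_i x 0 i)).
    by rewrite mulf_neq0 ?expf_neq0.
  by rewrite mulr0 mulrDr e; ring.
exists (fun i => g (delta_mx 0 i)) => s; rewrite gE; congr (_ * _).
rewrite [s in LHS]row_sum_delta; apply: additive_expand => //.
exact: linepoly_additive.
Qed.

End Homogeneity.

(** * Replacing one column of a matrix, and quadratic forms *)

Section ColumnReplacement.
Variables (R : realFieldType) (n : nat).
Implicit Types (M Q : 'M[R]_n) (u v : 'cV[R]_n) (i j k l : 'I_n).

Definition setcol M j u : 'M[R]_n :=
  \matrix_(a, b) if b == j then u a 0 else M a b.

Lemma setcol_col M j : setcol M j (col j M) = M.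
Proof. by apply/matrixP => a b; rewrite !mxE; case: eqP => // ->. Qed.

Lemma col_setcol M j u k :
  col k (setcol M j u) = if k == j then u else col k M.
Proof. by apply/colP => a; rewrite !mxE; case: eqP => //; rewrite mxE. Qed.

Lemma mul_setcol Q M j u : Q *m setcol M j u = setcol (Q *m M) j (Q *m u).
Proof.
apply/matrixP => a b; rewrite !mxE; case: (eqVneq b j) => bj; last first.
  by apply: eq_bigr => k _; rewrite mxE (negPf bj).
by apply: eq_bigr => k _; rewrite mxE bj eqxx.
Qed.

Lemma setcolZ M j a u :
  setcol M j (a *: u) =
  setcol M j u *m diag_mx (\row_l (if l == j then a else 1)).
Proof.
apply/matrixP => p q; rewrite mul_mx_diag !mxE.
by case: eqP => _; rewrite ?mulr1 // mulrC.
Qed.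

Lemma setcol_affine M j u v :
  exists N : 'M[R]_n, forall s : R, setcol M j (u + s *: v) = setcol M j u + s *: N.
Proof.
exists (setcol 0 j v) => s; apply/matrixP => a b; rewrite !mxE.
by case: eqP => // _; rewrite mulr0 addr0.
Qed.

Lemma cV_sum_delta u : u = \sum_j u j 0 *: delta_mx j 0.
Proof.
rewrite [u in LHS]matrix_sum_delta; apply: eq_bigr => j _.
by rewrite big_ord1.
Qed.

(** The polarization [b] is bilinear and vanishes on pairs of basis vectors, and
    [b u u = 2 * q u]. *)
Lemma quadratic_eq0 (q : 'cV[R]_n -> R) : linepoly q ->
  (forall s u, s != 0 -> q (s *: u) = s ^+ 2 * q u) ->
  (forall j, q (delta_mx j 0) = 0) ->
  (forall j l, j != l -> q (delta_mx j 0 + delta_mx l 0) = 0) ->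
  forall u, q u = 0.
Proof.
move=> lq hq qe qee u; pose b u v := q (u + v) - q u - q v.
have quad := linepoly_quadratic lq hq.
have bC x y : b x y = b y x by rewrite /b (addrC x y) addrAC.
have bZ s x y : s != 0 -> b (s *: x) y = s * b x y.
  by move=> s0; rewrite bC /b quad hq // (addrC y x); ring.
have lb y : linepoly (b^~ y).
  apply: linepolyD; last first.
    by move=> x z; exists (- q y)%:P => s; rewrite hornerC.
  apply: linepolyD; last first.
    by move=> x z; have [r rE] := lq x z; exists (- r) => s; rewrite hornerN rE.
  by apply: linepoly_affine lq => x z; exists z => s; rewrite addrAC.
have bD y x z : b (x + z) y = b x y + b z y.
  exact: (linepoly_additive (lb y) (fun s x => @bZ s x y)).
have bE x y : b x y = \sum_j x j 0 * b (delta_mx j 0) y.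
  rewrite [x in LHS]cV_sum_delta.
  by apply: (@additive_expand _ _ (b^~ y)) => [s z /bZ|z w] //; apply: bD.
have qD x : q (x + x) = 2 ^+ 2 * q x by rewrite -mulr2n -scaler_nat hq ?pnatr_eq0.
have buu : b u u = 2 * q u by rewrite /b qD; ring.
have bee j l : b (delta_mx j 0) (delta_mx l 0) = 0.
  have [<-|jl] := eqVneq j l; last by rewrite /b qee // !qe !subr0.
  by rewrite /b qD qe mulr0 !subr0.
have /eqP : 2 * q u = 0; last by rewrite mulf_eq0 pnatr_eq0 => /eqP.
rewrite -buu bE.
rewrite big1 // => j _; rewrite bC bE big1 ?mulr0 // => l _.
by rewrite bee mulr0.
Qed.

End ColumnReplacement.

(** * Equivariant maps of degree n + 1 and their parts *)

Section DeterminantalMaps.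
Variables (R : realFieldType) (n : nat).
Implicit Types (M Q : 'M[R]_n) (u v : 'cV[R]_n) (i j k l : 'I_n).

(** The properties of the determinant times a center, required of all matrices, singular ones
    included. *)
Record determinantal (G : 'M[R]_n -> 'cV[R]_n) : Prop := Determinantal {
  det_poly : forall k, polyfun (@mxcoord R n n) (fun M => G M k 0);
  det_orth : forall Q M, Q^T *m Q = 1%:M -> G (Q *m M) = \det Q *: (Q *m G M);
  det_scale : forall a M, a != 0 -> G (a *: M) = a ^+ n.+1 *: G M;
  det_swap : forall j l M, j != l -> G (xcol j l M) = - G M;
  det_col0 : forall j M, col j M = 0 -> G M = 0 }.

Variable G : 'M[R]_n -> 'cV[R]_n.
Hypothesis dG : determinantal G.

(** Doubling column [i] multiplies the part quadratic in it by 4 and the other parts by 2.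
    Subtracting [2 *: G M] therefore leaves twice the wanted part, which [part] halves. *)
Definition dbl i : 'rV[R]_n := \row_l (if l == i then 2 else 1).

(* G has degree at least 1 in each column and total degree n + 1, so it is a sum
   of parts that are quadratic in one column and linear in the others. *)
Definition part i M : 'cV[R]_n :=
  2^-1 *: (G (M *m diag_mx (dbl i)) - 2 *: G M).

Lemma prod_dbl i : \prod_l dbl i 0 l = 2.
Proof.
rewrite (bigD1 i) //= mxE eqxx big1 ?mulr1 // => l /negPf li.
by rewrite mxE li.
Qed.

Lemma sum_dbl i (V : lmodType R) (a : 'I_n -> V) :
  \sum_l dbl i 0 l *: a l = \sum_l a l + a i.
Proof.
rewrite (bigD1 i) //= [X in _ = X + _](bigD1 i) //= addrAC mxE eqxx.
congr (_ + _); first by rewrite scaler_nat mulr2n.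
by apply: eq_bigr => l /negPf li; rewrite mxE li scale1r.
Qed.

(** As a function of the scaling [s], each coordinate of [G] satisfies the hypotheses of
    [polyfun_prod_linear]; the values at [const_mx 1] and at [dbl i] identify its coefficients with
    the parts. *)
Lemma part_sum M s :
  G (M *m diag_mx s) = \prod_l s 0 l *: \sum_i s 0 i *: part i M.
Proof.
apply/colP => k; rewrite mxE summxE.
pose f (s : 'rV[R]_n) := G (M *m diag_mx s) k 0.
have pf : polyfun (@mxcoord R 1 n) f.
  apply: (polyfun_comp (h := fun s => M *m diag_mx s) _ (det_poly dG k)).
  case=> a b; apply: (eq_polyfun (f := fun s : 'rV[R]_n => M a b * s 0 b)).
    by move=> t; rewrite /mxcoord /= mul_mx_diag mxE.
  by apply: polyfun_mul (polyfun_cst _ _) (polyfun_entry _ _ _).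
have [||a aE] := polyfun_prod_linear pf.
- move=> i t ti; rewrite /f (det_col0 dG (j := i)) ?mxE //.
  by apply/colP => b; rewrite mul_mx_diag !mxE ti mulr0.
- move=> b t b0; rewrite /f (_ : diag_mx (b *: t) = b *: diag_mx t).
    by rewrite -scalemxAr det_scale // mxE.
  by apply/matrixP => p q; rewrite !mxE mulrnAr.
rewrite -[LHS]/(f s) aE; congr (_ * _); apply: eq_bigr => i _.
rewrite mxE; congr (_ * _); rewrite !mxE -[G _ k 0]/(f _) aE prod_dbl.
have -> : G M k 0 = \sum_i a i.
  have := aE (const_mx 1); rewrite /f diag_const_mx mulmx1 => ->.
  rewrite big1 ?mul1r; last by move=> l _; rewrite mxE.
  by apply: eq_bigr => l _; rewrite mxE mul1r.
rewrite (sum_dbl i (a : 'I_n -> R^o)).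
by rewrite -mulrBr addrAC subrr add0r mulrA mulVf ?pnatr_eq0 // mul1r.
Qed.

Lemma part_diag i M s :
  part i (M *m diag_mx s) = (\prod_l s 0 l * s 0 i) *: part i M.
Proof.
have -> : part i (M *m diag_mx s) =
    2^-1 *: (G (M *m diag_mx (\row_l (s 0 l * dbl i 0 l))) - 2 *: G (M *m diag_mx s)).
  rewrite /part -mulmxA; congr (_ *: (G (_ *m _) - _)).
  by apply/matrixP => a b; rewrite mul_diag_mx !mxE -mulrnAr.
rewrite !part_sum.
under eq_bigr do rewrite mxE.
under [X in _ *: X - _]eq_bigr do rewrite mxE mulrC -scalerA.
rewrite big_split /= prod_dbl sum_dbl [_ * 2]mulrC -[(2 * _) *: _]scalerA -scalerBr.
rewrite [in LHS]scalerA mulVf ?pnatr_eq0 // scale1r scalerDr addrAC subrr add0r.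
by rewrite scalerA.
Qed.

Lemma part_orth i Q M : Q^T *m Q = 1%:M ->
  part i (Q *m M) = \det Q *: (Q *m part i M).
Proof.
move=> oQ; rewrite /part -mulmxA !(det_orth dG _ oQ).
by rewrite -[in RHS]scalemxAr mulmxBr -[in RHS]scalemxAr; apply/colP => k; rewrite !mxE; ring.
Qed.

Lemma part_swap i j l M : j != l -> j != i -> l != i ->
  part i (xcol j l M) = - part i M.
Proof.
move=> jl ji li.
have e : xcol j l M *m diag_mx (dbl i) = xcol j l (M *m diag_mx (dbl i)).
  apply/matrixP => a b; rewrite !mul_mx_diag !mxE.
  by case: tpermP => [->|->|//]; rewrite ?(negPf ji) ?(negPf li).
by rewrite /part e !(det_swap dG) //; apply/colP => k; rewrite !mxE; ring.
Qed.

Lemma part_linepoly i k : linepoly (fun M => part i M k 0).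
Proof.
pose f M := 2^-1 * (G (M *m diag_mx (dbl i)) k 0 + -2 * G M k 0).
rewrite (_ : (fun M => _) = f).
  have lG := polyfun_linepoly (det_poly dG k).
  apply: linepolyZ; apply: linepolyD; last exact: linepolyZ.
  apply: (linepoly_affine (h := fun M => M *m diag_mx (dbl i))) lG => A B.
  by exists (B *m diag_mx (dbl i)) => s; rewrite mulmxDl scalemxAl.
by apply/funext => M; rewrite /part /f !mxE mulNr.
Qed.

Lemma part_setcol_linepoly i M j k : linepoly (fun u => part i (setcol M j u) k 0).
Proof.
apply: (linepoly_affine (h := setcol M j)) (part_linepoly i k) => u v.
exact: setcol_affine.
Qed.

Lemma prod_if j (a : R) : \prod_l (if l == j then a else 1) = a.
Proof. by rewrite (bigD1 j) //= eqxx big1 ?mulr1 // => l /negPf ->. Qed.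

Lemma part_setcolZ i M j a u :
  part i (setcol M j (a *: u)) =
  (if i == j then a ^+ 2 else a) *: part i (setcol M j u).
Proof.
rewrite setcolZ part_diag; congr (_ *: _).
under eq_bigr do rewrite mxE.
by rewrite prod_if mxE; case: eqP; rewrite ?mulr1.
Qed.

Lemma part_setcol_expand i M j u : j != i ->
  part i (setcol M j u) = \sum_l u l 0 *: part i (setcol M j (delta_mx l 0)).
Proof.
move=> ji; apply/colP => k; rewrite summxE.
under eq_bigr do rewrite mxE.
rewrite [u in LHS]cV_sum_delta.
have hs s v : s != 0 -> part i (setcol M j (s *: v)) k 0 = s * part i (setcol M j v) k 0.
  by move=> _; rewrite part_setcolZ eq_sym (negPf ji) mxE.
apply: (@additive_expand _ _ (fun u => part i (setcol M j u) k 0)) => // x y.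
exact: (linepoly_additive (@part_setcol_linepoly i M j k) hs).
Qed.

(** Off [i], the function [f] takes at most n - 1 values, so some [m] is missed and can serve as the
    image of [i]. *)
Lemma perm_extension i (f : 'I_n -> 'I_n) :
  {in [pred j | j != i] &, injective f} ->
  exists s : 'S_n, forall j, j != i -> s j = f j.
Proof.
move=> fI; pose S := [set f j | j in [set~ i]].
have [m mS] : exists m, m \notin S.
  apply/existsP; rewrite -negb_forall; apply/negP => /forallP allS.
  have : (n <= #|S|)%N.
    rewrite -[n in (n <= _)%N]card_ord; apply: subset_leq_card; apply/fintype.subsetP => m _.
    exact: allS.
  rewrite leqNgt => /negP; apply; apply: leq_ltn_trans (leq_imset_card _ _) _.
  by rewrite cardsC1 card_ord ltn_predL (leq_ltn_trans _ (ltn_ord i)).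
have fm j : j != i -> f j != m.
  by move=> ji; apply: contraNneq mS => <-; apply/imsetP; exists j; rewrite ?in_setC1.
pose g j := if j == i then m else f j.
have gI : injective g.
  move=> j l; rewrite /g; case: (eqVneq j i) => [->|ji]; case: (eqVneq l i) => [->|li] //.
  - by move=> e; have := fm _ li; rewrite e eqxx.
  - by move=> e; have := fm _ ji; rewrite e eqxx.
  by apply: fI.
by exists (perm gI) => j ji; rewrite permE /g (negPf ji).
Qed.

(* The part i is linear and alternating in the columns other than i: it is enough
   to know it when these are distinct basis vectors, which may be renumbered. *)
Lemma part_eq0 i : (forall u, part i (setcol 1%:M i u) = 0) ->
  forall M, part i M = 0.
Proof.
move=> p0 M.
(* The list [r] holds the columns that are still arbitrary; each is expanded in the basis in
   turn. *)
suff: forall (r : seq 'I_n) M,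
    (forall j, j != i -> j \notin r -> exists l, col j M = delta_mx l 0) ->
    part i M = 0.
  by move=> /(_ (enum 'I_n) M); apply=> j _; rewrite mem_enum.
elim=> [{}M eM|j r IHr {}M eM]; last first.
  have [ji|ji] := eqVneq j i.
    by apply: IHr => l li lr; apply: eM; rewrite ?inE // ji negb_or li.
  rewrite -(setcol_col M j) part_setcol_expand // big1 // => a _.
  rewrite IHr ?scaler0 // => l li lr; rewrite col_setcol.
  case: (eqVneq l j) => [_|lj]; first by exists a.
  by apply: eM; rewrite ?inE ?negb_or ?lj.
have {eM} /choice[f fE] : forall j, exists l, j != i -> col j M = delta_mx l 0.
  move=> j; case: (eqVneq j i) => [_|ji]; first by exists i.
  by have [//|l lE] := eM j ji; exists l.
have [/existsP[j /existsP[l /and4P[ji li jl /eqP fjl]]]|nex] := boolP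
    [exists j, exists l, [&& j != i, l != i, j != l & f j == f l]].
  (* Exchanging two equal columns changes the sign and not the matrix. *)
  have : part i M = - part i M.
    rewrite -(part_swap M jl ji li); congr part.
    have e : col j M = col l M by rewrite !fE // fjl.
    apply/matrixP => a b; rewrite !mxE; case: tpermP => [->|->|//].
      by have /colP/(_ a) := e; rewrite !mxE.
    by have /colP/(_ a) := e; rewrite !mxE.
  move/eqP; rewrite -addr_eq0 -mulr2n -scaler_nat scaler_eq0 pnatr_eq0 /=.
  by move/eqP.
have [s sE] : exists s : 'S_n, forall j, j != i -> s j = f j.
  apply: perm_extension => j l; rewrite !inE => ji li fjl.
  apply/eqP; apply: contraNT nex => jl; apply/existsP; exists j.
  by apply/existsP; exists l; rewrite ji li jl fjl eqxx.
have oP : (perm_mx s)^T^T *m (perm_mx s)^T = 1%:M :> 'M[R]_n.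
  by rewrite trmxK tr_perm_mx -perm_mxM mulgV perm_mx1.
(* Renumbering the basis by an orthogonal matrix turns all columns but [i] into those of the
   identity. *)
have -> : M = (perm_mx s)^T *m setcol 1%:M i (perm_mx s *m col i M).
  rewrite mul_setcol mulmx1 mulmxA tr_perm_mx -perm_mxM mulVg perm_mx1 mul1mx.
  apply/matrixP => a b; rewrite !mxE; case: (eqVneq b i) => [->//|bi].
  have /colP/(_ a) := fE b bi; rewrite -sE // !mxE andbT => ->.
  by rewrite -(inj_eq (@perm_inj _ s^-1%g)) permK.
by rewrite part_orth // p0 mulmx0 scaler0.
Qed.

End DeterminantalMaps.

(** * A determinantal map is determined by two kinds of values *)

Section Rigidity.
Variables (R : realFieldType) (n : nat).
Variable G : 'M[R]_n -> 'cV[R]_n.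
Hypothesis dG : determinantal G.
Implicit Types (M Q : 'M[R]_n) (u v : 'cV[R]_n) (i j k l : 'I_n).

Local Notation e j := (delta_mx j 0 : 'cV[R]_n).

Lemma setcol_id i : setcol 1%:M i (e i) = 1%:M :> 'M[R]_n.
Proof. by rewrite -[RHS](setcol_col _ i) colE mul1mx. Qed.

Definition flip j : 'M[R]_n := diag_mx (\row_l (if l == j then -1 else 1)).

Lemma flipE j u k : (flip j *m u) k 0 = (if k == j then - u k 0 else u k 0).
Proof. by rewrite mul_diag_mx !mxE; case: eqP; rewrite ?mulN1r ?mul1r. Qed.

Lemma det_flip j : \det (flip j) = -1.
Proof. by rewrite det_diag; under eq_bigr do rewrite mxE; rewrite prod_if. Qed.

Lemma flip_orth j : (flip j)^T *m flip j = 1%:M.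
Proof.
rewrite tr_diag_mx mulmx_diag -diag_const_mx; congr diag_mx.
by apply/rowP => l; rewrite !mxE; case: eqP; rewrite ?mulrNN mulr1.
Qed.

Section Part.
Variable i : 'I_n.

(** The quadratic map to which [part_eq0] reduces the vanishing of [part G i]. *)
Let phi u := part G i (setcol 1%:M i u).

Let phiZ a u : phi (a *: u) = a ^+ 2 *: phi u.
Proof. by rewrite /phi part_setcolZ // eqxx. Qed.

(** Flipping coordinate [j] also negates column [j] of the identity; undoing this costs a sign,
    which cancels the determinant -1 of the flip. *)
Let phi_flip j u : j != i -> phi (flip j *m u) = flip j *m phi u.
Proof.
move=> ji; have := part_orth dG i (setcol 1%:M i u) (flip_orth j).
rewrite mul_setcol mulmx1 det_flip.
have -> : setcol (flip j) i (flip j *m u) = setcol 1%:M i (flip j *m u) *m flip j.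
  apply/matrixP => a b; rewrite [in RHS]mul_mx_diag !mxE.
  have [->|bi] := eqVneq b i; first by rewrite eq_sym (negPf ji) mulr1.
  by case: (eqVneq a b) => [->|ab]; rewrite ?mul1r ?mul0r ?mulr0n ?mulr1n.
rewrite part_diag //; under eq_bigr do rewrite mxE.
by rewrite prod_if mxE eq_sym (negPf ji) mulr1 !scaleN1r => /oppr_inj.
Qed.

Let quad k u v s : phi (u + s *: v) k 0 =
  phi u k 0 + s * (phi (u + v) k 0 - phi u k 0 - phi v k 0) + s ^+ 2 * phi v k 0.
Proof.
apply: (@linepoly_quadratic _ _ (fun u => phi u k 0)) => [|a w _].
  exact: part_setcol_linepoly.
by rewrite phiZ mxE.
Qed.

Let flip_e j l : flip j *m e l = (if l == j then -1 else 1) *: e l.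
Proof.
apply/colP => k; rewrite flipE !mxE andbT.
have [->|kl] := eqVneq k l; first by case: eqP; rewrite mulr1.
by rewrite oppr0 if_same mulr0.
Qed.

(** Flipping coordinate [k] sends [e l] to itself or its opposite, which [phi] does not distinguish,
    but negates the coordinate [k] of the value. *)
Let phi_e l k : k != i -> phi (e l) k 0 = 0.
Proof.
move=> ki; have /colP/(_ k) := phi_flip (e l) ki.
rewrite flipE eqxx flip_e phiZ mxE (_ : _ ^+ 2 = 1) ?mul1r.
  by move=> h; lra.
by case: eqP; rewrite ?sqrrN expr1n.
Qed.

(** By [phi_flip], [e a + e j] and [e a - e j] give the same coordinate [k], so the mixed term is
    zero. *)
Let phi_ee a j k : j != i -> a != j -> k != j ->
  phi (e a + e j) k 0 = phi (e a) k 0 + phi (e j) k 0.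
Proof.
move=> ji aj kj; have /colP/(_ k) := phi_flip (e a + e j) ji.
rewrite flipE (negPf kj) mulmxDr !flip_e (negPf aj) eqxx scale1r quad.
by rewrite sqrrN expr1n => h; lra.
Qed.

Hypothesis phi_ei : phi (e i) i 0 = 0.
Hypothesis phi_eij : forall j, j != i -> phi (e i + e j) j 0 = 0.

Let phi_i : phi (e i) = 0.
Proof.
apply/colP => k; rewrite [RHS]mxE; have [->|ki] := eqVneq k i; first exact: phi_ei.
exact: phi_e.
Qed.

Let phi_plane j s k : j != i -> phi (e i + s *: e j) k 0 = s ^+ 2 * phi (e j) k 0.
Proof.
move=> ji; rewrite quad phi_i mxE !add0r subr0.
have [->|kj] := eqVneq k j; first by rewrite phi_eij // phi_e // subr0 !mulr0 addr0.
by rewrite phi_ee // 1?eq_sym // phi_i mxE add0r subrr mulr0 add0r.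
Qed.

(* With Q the reflection sending e_i to w = (3 e_i + 4 e_j) / 5, equivariance gives
   part i Q = 0; expanding the column Q e_j = (4 e_i - 3 e_j) / 5 then yields
   phi (e_j) = 0. *)
Let phi_j j : j != i -> phi (e j) = 0.
Proof.
move=> ji; have ij : i != j by rewrite eq_sym.
(* Here [w] is a normal vector of the mirror, of squared length 5; the image of [e i] is named [x]
   below. The slope 2 makes the entries of [Q] rational (3-4-5 triangle). *)
pose w := e i - 2 *: e j; pose Q : 'M[R]_n := 1%:M - (2 / 5) *: (w *m w^T).
have wT : w^T = delta_mx 0 i - 2 *: delta_mx 0 j.
  by rewrite linearB /= linearZ /= !trmx_delta.
have ww : w^T *m w = 5%:M.
  rewrite wT /w mulmxBl !mulmxBr -!scalemxAl -!scalemxAr.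
  rewrite !mul_delta_mx_cond !eqxx (negPf ij) (negPf ji) !mulr0n !mulr1n.
  apply/matrixP => a b; rewrite !ord1 !mxE eqxx; ring.
have trQ : Q^T = Q.
  by rewrite /Q linearB linearZ /= trmx_mul trmxK trmx1.
have oQ : Q^T *m Q = 1%:M.
  rewrite trQ /Q; set W := w *m w^T; have WW : W *m W = 5 *: W.
    by rewrite mulmxA -[w *m _ *m w]mulmxA ww mul_mx_scalar -scalemxAl.
  move: (W) WW => {}W WW; rewrite mulmxBl !mulmxBr !mul1mx !mulmx1.
  by rewrite -scalemxAl -scalemxAr WW; apply/matrixP => p q; rewrite !mxE; field.
have Qcol u : Q *m u = u - (2 / 5 * (w^T *m u) 0 0) *: w.
  rewrite mulmxBl mul1mx -scalemxAl -mulmxA; congr (_ - _).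
  by rewrite {1}[w^T *m u]mx11_scalar mul_mx_scalar scalerA.
have wk k : (w^T *m e k) 0 0 = (k == i)%:R - 2 * (k == j)%:R.
  by rewrite -colE !mxE !andbT.
pose x := (3 / 5) *: e i + (4 / 5) *: e j.
have Qi : Q *m e i = x.
  rewrite Qcol wk eqxx (negPf ij); apply/colP => k; rewrite !mxE.
  by rewrite !andbT /=; field.
have Qj : Q *m e j = (4 / 5) *: e i - (3 / 5) *: e j.
  rewrite Qcol wk eqxx (negPf ji); apply/colP => k; rewrite !mxE.
  by rewrite !andbT /=; field.
have Q0 : part G i Q = 0.
  have p1 : part G i 1%:M = 0 by have := phi_i; rewrite /phi setcol_id.
  by have := part_orth dG i 1%:M oQ; rewrite mulmx1 p1 mulmx0 scaler0.
have QE : Q = setcol (setcol 1%:M i x) j (Q *m e j).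
  apply/matrixP => a b; rewrite [RHS]mxE; case: (eqVneq b j) => [->|bj].
    by rewrite -colE [RHS]mxE.
  rewrite [RHS]mxE -Qi; case: (eqVneq b i) => [->|bi]; first by rewrite -colE [RHS]mxE.
  transitivity ((Q *m e b) a 0); first by rewrite -colE [RHS]mxE.
  by rewrite Qcol wk (negPf bi) (negPf bj) mulr0 subrr mulr0 scale0r subr0 mxE andbT [RHS]mxE.
have x_i k : phi x k 0 = 16 / 25 * phi (e j) k 0.
  rewrite (_ : x = (3 / 5) *: (e i + (4 / 3) *: e j)).
    by rewrite phiZ mxE phi_plane //; field.
  by rewrite scalerDr scalerA; congr (_ + _ *: _); field.
pose S : 'M[R]_n := tperm_mx i j.
have SS : S *m S = 1%:M by rewrite /S -perm_mxM tperm2 perm_mx1.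
have oS : S^T *m S = 1%:M by rewrite /S tr_tperm_mx.
have Se k : S *m e k = e (tperm i j k).
  apply/colP => a; rewrite -colE !mxE andbT.
  by rewrite -(inj_eq (@perm_inj _ (tperm i j))) tpermK.
have Sx : S *m x = (4 / 5) *: (e i + (3 / 4) *: e j).
  rewrite mulmxDr -!scalemxAr !Se tpermL tpermR scalerDr scalerA addrC.
  by congr (_ + _ *: _); field.
(* Exchanging coordinates [i] and [j] makes column [j] equal to [e j] again, and turns this entry
   into the coordinate [j] of [phi (S *m x)], which vanishes by [phi_plane] and [phi_e]. *)
have N1 : part G i (setcol (setcol 1%:M i x) j (e i)) i 0 = 0.
  have -> : setcol (setcol 1%:M i x) j (e i) = S *m setcol 1%:M i (S *m x).
    rewrite mul_setcol mulmx1 mulmxA SS mul1mx.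
    apply/matrixP => a b; rewrite !mxE.
    have [->|bj] := eqVneq b j.
      by rewrite (negPf ji) andbT -(inj_eq (@perm_inj _ (tperm i j))) tpermL.
    have [_ //|bi] := eqVneq b i.
    by rewrite -(inj_eq (@perm_inj _ (tperm i j))) (tpermD (z := b)) // eq_sym.
  rewrite part_orth // -/(phi _) mxE Sx phiZ -scalemxAr mxE.
  rewrite -[X in S *m X]/(phi _).
  rewrite (_ : (S *m phi _) i 0 = phi (e i + (3 / 4) *: e j) j 0).
    by rewrite phi_plane // phi_e // !mulr0.
  by rewrite /S -xrowE mxE tpermL.
have N2 : setcol (setcol 1%:M i x) j (e j) = setcol 1%:M i x.
  apply/matrixP => a b; rewrite !mxE; have [->|bj //] := eqVneq b j.
  by rewrite (negPf ji) andbT.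
apply/colP => k; rewrite [RHS]mxE; have [->|ki] := eqVneq k i; last exact: phi_e.
(* The coordinate [i] of the expansion is 4/5 times the entry in [N1], which is zero, minus 3/5
   times that of [phi x], which by [x_i] is 16/25 times that of [phi (e j)]. *)
have /colP/(_ i) := Q0; rewrite [in part _ _ _]QE Qj part_setcol_expand // summxE.
rewrite (bigD1 i) //= (bigD1 j) //= big1 ?addr0; last first.
  by move=> l /andP[li lj]; rewrite !mxE (negPf li) (negPf lj) /=; ring.
rewrite N2 [X in X + _]mxE N1 mulr0 add0r mxE -[part _ _ _]/(phi x) x_i.
rewrite !mxE !eqxx (negPf ji) /= => h.
by lra.
Qed.

Lemma part_vanishes M : part G i M = 0.
Proof.
apply: part_eq0 => // u; apply/colP => k; rewrite [RHS]mxE -/(phi _).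
have phi0 l : phi (e l) = 0.
  by have [->|li] := eqVneq l i; [exact: phi_i | exact: phi_j].
apply: (@quadratic_eq0 _ _ (fun u => phi u k 0)) => {u} [|s u _|j|].
- exact: part_setcol_linepoly.
- by rewrite phiZ mxE.
- by rewrite phi0 mxE.
(* At least one of the two indices differs from [i]; by symmetry it may be the second. *)
suff h j l : l != i -> j != l -> phi (e j + e l) k 0 = 0.
  move=> j l jl; have [li|] := eqVneq l i; last by move=> li; apply: h.
  by rewrite addrC; apply: h; rewrite -?li // eq_sym.
move=> li jl; have [kl|kl] := eqVneq k l; last by rewrite phi_ee // !phi0 mxE addr0.
have [ji|ji] := eqVneq j i; first by rewrite ji kl phi_eij.
by rewrite addrC phi_ee // ?kl 1?eq_sym // !phi0 mxE addr0.
Qed.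

End Part.

Lemma determinantal_eq0 : (forall i, part G i 1%:M i 0 = 0) ->
  (forall i j, j != i -> part G i (setcol 1%:M i (e i + e j)) j 0 = 0) ->
  forall M, G M = 0.
Proof.
move=> h1 h2 M; have := part_sum dG M (const_mx 1).
rewrite diag_const_mx mulmx1 => ->; rewrite [X in _ *: X]big1 ?scaler0 // => i _.
by rewrite part_vanishes ?scaler0 // ?setcol_id //; apply: h2.
Qed.

End Rigidity.

(** * Centers of simplices with a vertex at the origin *)

Section CenterLike.
Variables (R : realFieldType) (n : nat).
Implicit Types (M Q : 'M[R]_n) (u v : 'cV[R]_n) (i j k l : 'I_n).
Implicit Types (c : 'M[R]_n -> 'cV[R]_n).

(* If the columns of M are the vertices of a simplex whose remaining vertex is the
   origin, those of [rebase j M] come from moving the j-th vertex to the origin and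
   listing the former origin in its place. *)
Definition rebase j M : 'M[R]_n :=
  \matrix_(a, b) (M a b - (b == j).+1%:R * M a j).

Lemma rebase_mul j M : rebase j M = M *m rebase j 1%:M.
Proof.
apply/matrixP => a b; rewrite !mxE.
under eq_bigr do rewrite !mxE mulrBr mulrCA.
rewrite sumrB -mulr_sumr.
have e k : \sum_l M a l * (l == k)%:R = M a k.
  rewrite (bigD1 k) //= eqxx mulr1 big1 ?addr0 // => l /negPf ->.
  by rewrite mulr0.
by rewrite !e.
Qed.

(** The factor [(b == j).+1] is 2 at [b = j], which negates column [j]; the other columns only lose
    a copy of it. *)
Lemma det_rebase j M : \det (rebase j M) = - \det M.
Proof.
rewrite rebase_mul det_mulmx [\det (rebase _ _)](expand_det_col _ j) (bigD1 j) //= big1 ?addr0.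
  rewrite !mxE eqxx /cofactor addnn -signr_odd odd_double mul1r.
  rewrite (_ : row' j _ = 1%:M) ?det1; first by rewrite /=; ring.
  have lj a : (lift j a == j) = false by rewrite eq_sym (negPf (neq_lift _ _)).
  by apply/matrixP => a b; rewrite !mxE (inj_eq lift_inj) !lj mulr0 subr0.
by move=> l lj; rewrite !mxE eqxx (negPf lj) mulr0 subr0 mul0r.
Qed.

(** The weight [tau] is 1 for a genuine center; allowing other weights makes the notion stable under
    linear combinations such as those of [center_likeB]. *)
Record center_like c (tau : R) : Prop := CenterLike {
  center_poly : forall k, exists2 g, polyfun (@mxcoord R n n) g
    & forall M, M \in unitmx -> g M = \det M * c M k 0;
  center_orth : forall Q M, Q^T *m Q = 1%:M -> M \in unitmx ->
    c (Q *m M) = Q *m c M;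
  center_scale : forall a M, 0 < a -> M \in unitmx -> c (a *: M) = a *: c M;
  center_swap : forall j l M, M \in unitmx -> c (xcol j l M) = c M;
  center_rebase : forall j M, M \in unitmx -> c (rebase j M) = c M - tau *: col j M }.

Lemma center_likeB c c' tau tau' a : center_like c tau -> center_like c' tau' ->
  center_like (fun M => c M - a *: c' M) (tau - a * tau').
Proof.
case=> p1 o1 s1 w1 r1 [p2 o2 s2 w2 r2]; split=> [k|Q M oQ uM|b M b0 uM|j l M uM|j M uM].
- have [[g pg gE] [g' pg' gE']] := (p1 k, p2 k).
  exists (fun M => g M + - a * g' M).
    by apply: polyfun_add => //; apply: polyfun_mul => //; apply: polyfun_cst.
  by move=> M uM; rewrite gE // gE' // !mxE; ring.
- by rewrite o1 // o2 // mulmxBr scalemxAr.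
- by rewrite s1 // s2 // scalerBr !scalerA mulrC.
- by rewrite w1 // w2.
- rewrite r1 // r2 //; apply/colP => k; rewrite !mxE; ring.
Qed.

Lemma polyfun_mulmx (T I : Type) (x : I -> T -> R) m p q
    (A : T -> 'M[R]_(m, p)) (B : T -> 'M[R]_(p, q)) a b :
  (forall a b, polyfun x (fun t => A t a b)) ->
  (forall a b, polyfun x (fun t => B t a b)) ->
  polyfun x (fun t => (A t *m B t) a b).
Proof.
move=> pA pB; pose f t := \sum_l A t a l * B t l b.
apply: (@eq_polyfun _ _ _ _ f); first by move=> t; rewrite mxE.
by apply: polyfun_sum => l; apply: polyfun_mul.
Qed.

Lemma polyfun_eq_unitmx (F H : 'M[R]_n -> 'cV[R]_n) :
  (forall k, polyfun (@mxcoord R n n) (fun M => F M k 0)) ->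
  (forall k, polyfun (@mxcoord R n n) (fun M => H M k 0)) ->
  {in unitmx, F =1 H} -> F =1 H.
Proof.
move=> pF pH FH M; apply/colP => k.
apply: (@linepoly_eq_unitmx _ _ (fun M => F M k 0) (fun M => H M k 0)).
- exact: polyfun_linepoly.
- exact: polyfun_linepoly.
- by move=> N uN /=; rewrite FH.
Qed.

(** Each identity is checked on invertible matrices, where [G] is the determinant times [c], and
    extends to all matrices by polynomiality. *)
Lemma center_determinantal c tau : center_like c tau ->
  exists2 G, determinantal G & {in unitmx, forall M, G M = \det M *: c M}.
Proof.
case=> cp co cs cw cr.
have /choice[g gE] : forall k, exists g, polyfun (@mxcoord R n n) g /\
    forall M, M \in unitmx -> g M = \det M * c M k 0.
  by move=> k; have [g pg gE] := cp k; exists g.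
pose G M := \col_k g k M.
have GE : {in unitmx, forall M, G M = \det M *: c M}.
  by move=> M uM; apply/colP => k; rewrite !mxE; apply: (gE k).2.
have pG k : polyfun (@mxcoord R n n) (fun M => G M k 0).
  by apply: eq_polyfun (gE k).1 => M; rewrite mxE.
have pGh (h : 'M[R]_n -> 'M[R]_n) k :
    (forall a b, polyfun (@mxcoord R n n) (fun M => h M a b)) ->
    polyfun (@mxcoord R n n) (fun M => G (h M) k 0).
  by move=> ph; apply: (polyfun_comp _ (pG k)) => -[a b]; apply: ph.
have pM (a b : 'I_n) := polyfun_entry R a b.
have pcst a := polyfun_cst (@mxcoord R n n) a.
have Gorth Q M : Q^T *m Q = 1%:M -> G (Q *m M) = \det Q *: (Q *m G M).
  move=> oQ; pose H M := \det Q *: (Q *m G M).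
  apply: (@polyfun_eq_unitmx (fun M => G (Q *m M)) H) => {M} [k|k|M uM].
  - by apply: pGh => a b; apply: polyfun_mulmx.
  - apply: (@eq_polyfun _ _ _ _ (fun M => \det Q * (Q *m G M) k 0)).
      by move=> M; rewrite /H [RHS]mxE.
    apply: polyfun_mul => //; apply: polyfun_mulmx => // a b.
    by rewrite (ord1 b).
  have uQ : Q \in unitmx by case: (mulmx1_unit oQ).
  rewrite /H !GE ?unitmx_mul ?uQ // co // det_mulmx.
  by rewrite -scalemxAr scalerA.
exists G => //; split=> // [a M a0|j l M jl|j M Mj].
- have pos b N : 0 < b -> G (b *: N) = b ^+ n.+1 *: G N.
    move=> b0; pose H M := b ^+ n.+1 *: G M.
    apply: (@polyfun_eq_unitmx (fun N => G (b *: N)) H) => {N} [k|k|N uN].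
    + apply: pGh => p q; apply: (@eq_polyfun _ _ _ _ (fun N : 'M[R]_n => b * N p q)).
        by move=> N; rewrite mxE.
      exact: polyfun_mul.
    + apply: (@eq_polyfun _ _ _ _ (fun N => b ^+ n.+1 * G N k 0)).
        by move=> N; rewrite /H [RHS]mxE.
      exact: polyfun_mul.
    have ub : b *: N \in unitmx by rewrite unitmxZ // unitfE gt_eqF.
    by rewrite /H !GE // cs // detZ !scalerA exprSr; congr (_ *: _); ring.
  (* A negative scalar is a positive one times [- 1%:M], which is orthogonal of determinant
     (-1)^n. *)
  have [a_lt0|/pos -> //|a_eq0] := ltgtP a 0; last by rewrite a_eq0 eqxx in a0.
  have oN : (- 1%:M)^T *m (- 1%:M) = 1%:M :> 'M[R]_n.
    by rewrite mulmxN mulmx1 linearN /= trmx1 opprK.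
  have := Gorth _ (- a *: M) oN.
  rewrite !mulNmx !mul1mx scaleNr opprK => ->.
  rewrite -scaleNr pos ?oppr_gt0 // -scaleN1r detZ det1 -scaleN1r !scalerA.
  congr (_ *: _); rewrite mulr1 -exprSr -exprMn; congr (_ ^+ _); ring.
- apply: (@polyfun_eq_unitmx (fun M => G (xcol j l M)) (fun M => - G M)) => {M} [k|k|M uM].
  + apply: pGh => a b; apply: eq_polyfun (pM a (tperm j l b)) => N.
    by rewrite mxE.
  + apply: (@eq_polyfun _ _ _ _ (fun M => -1 * G M k 0)).
      by move=> M; rewrite [RHS]mxE mulN1r.
    exact: polyfun_mul.
  have dx : \det (xcol j l M) = - \det M.
    by rewrite xcolE det_mulmx det_perm odd_tperm jl expr1 mulrN1.
  have ux : xcol j l M \in unitmx by rewrite unitmxE dx unitrN -unitmxE.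
  by rewrite !GE // dx cw // scaleNr.
have rebaseE : G (rebase j M) = - G M + (tau * \det M) *: col j M.
  pose H M := - G M + (tau * \det M) *: col j M.
  apply: (@polyfun_eq_unitmx (fun M => G (rebase j M)) H) => {M Mj} [k|k|M uM].
  - apply: pGh => a b.
    apply: (@eq_polyfun _ _ _ _ (fun M => M a b + - (b == j).+1%:R * M a j)).
      by move=> M; rewrite mxE mulNr.
    by apply: polyfun_add => //; apply: polyfun_mul.
  - apply: (@eq_polyfun _ _ _ _ (fun M => -1 * G M k 0 + (tau * \det M) * M k j)).
      by move=> M; rewrite /H !mxE mulN1r.
    apply: polyfun_add; first exact: polyfun_mul.
    apply: polyfun_mul => //; apply: polyfun_mul => //.
    by apply: polyfun_det => a b.
  have ur : rebase j M \in unitmx by rewrite unitmxE det_rebase unitrN -unitmxE.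
  rewrite /H !GE // det_rebase cr //; apply/colP => k; rewrite !mxE; ring.
(* If column [j] is zero, rebasing changes nothing and [rebaseE] reads [G M = - G M]. *)
have rM : rebase j M = M.
  apply/matrixP => a b; rewrite mxE; have /colP/(_ a) := Mj.
  by rewrite !mxE => ->; rewrite mulr0 subr0.
move: rebaseE; rewrite rM Mj scaler0 addr0 => /eqP.
by rewrite -addr_eq0 -mulr2n -scaler_nat scaler_eq0 pnatr_eq0 => /eqP.
Qed.

Definition shear i j : 'M[R]_n := setcol 1%:M i (delta_mx i 0 + delta_mx j 0).

(** The change of [c] when column [i] is doubled is the part of [\det M *: c M], divided by
    [\det M]. So [gamma] and [beta] are the values on which [determinantal_eq0] depends. *)
Definition gamma c i := (c (diag_mx (dbl R i)) - c 1%:M) i 0.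
Definition beta c i j := (c (shear i j *m diag_mx (dbl R i)) - c (shear i j)) j 0.

Lemma unitmx_dbl i : diag_mx (dbl R i) \in unitmx.
Proof. by rewrite unitmxE det_diag prod_dbl unitfE pnatr_eq0. Qed.

Lemma unitmx_shear i j : j != i -> shear i j \in unitmx.
Proof.
move=> ji; have -> : shear i j = 1%:M + delta_mx j i.
  apply/matrixP => a b; rewrite !mxE andbT; have [->|bi] := eqVneq b i.
    by rewrite !andbT.
  by rewrite andbF addr0.
suff e : (1%:M + delta_mx j i) *m (1%:M - delta_mx j i) = 1%:M :> 'M[R]_n.
  by case: (mulmx1_unit e).
rewrite mulmxDl !mulmxBr !mul1mx mulmx1 mul_delta_mx_0 1?eq_sym //.
by rewrite subr0 subrK.
Qed.

Lemma center_like_eq0 c tau : center_like c tau ->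
  (forall i, gamma c i = 0) -> (forall i j, j != i -> beta c i j = 0) ->
  {in unitmx, forall M, c M = 0}.
Proof.
move=> cc g0 b0; have [G dG GE] := center_determinantal cc.
have partE i M : M \in unitmx ->
    part G i M = \det M *: (c (M *m diag_mx (dbl R i)) - c M).
  move=> uM; rewrite /part !GE ?unitmx_mul ?uM ?unitmx_dbl // det_mulmx.
  rewrite det_diag prod_dbl; apply/colP => k; rewrite !mxE.
  by field.
have Gz := determinantal_eq0 dG.
move=> M uM; apply/eqP; have : \det M *: c M == 0.
  rewrite -GE // Gz // => [i|i j ji].
    rewrite partE ?unitmx1 // mul1mx mxE -[X in _ * X]/(gamma c i) g0.
    by rewrite mulr0.
  rewrite -[setcol _ _ _]/(shear i j) partE ?unitmx_shear // mxE.
  by rewrite -[X in _ * X]/(beta c i j) b0 // mulr0.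
by rewrite scaler_eq0 -[\det M == 0]negbK -unitfE -unitmxE uM.
Qed.

Section Constancy.
Variables (c : 'M[R]_n -> 'cV[R]_n) (tau : R).
Hypothesis cc : center_like c tau.

(** [N] is [M] conjugated by a transposition: permuting rows is orthogonal, and permuting columns
    does not affect [c]. *)
Lemma center_conj p q M (N : 'M[R]_n) : M \in unitmx ->
  (forall a b, N a b = M (tperm p q a) (tperm p q b)) ->
  forall a, c N a 0 = c M (tperm p q a) 0.
Proof.
move=> uM NE a; pose S : 'M[R]_n := tperm_mx p q.
have oS : S^T *m S = 1%:M by rewrite /S tr_tperm_mx -perm_mxM tperm2 perm_mx1.
have -> : N = xcol p q (S *m M).
  by apply/matrixP => x y; rewrite /S -xrowE !mxE.
have uS : S \in unitmx by case: (mulmx1_unit oS).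
by rewrite (center_swap cc) ?unitmx_mul ?uS // (center_orth cc) // /S -xrowE mxE.
Qed.

Lemma gamma_tperm p q i : gamma c (tperm p q i) = gamma c i.
Proof.
rewrite /gamma !mxE; congr (_ - _); symmetry; apply: center_conj => [|a b].
- exact: unitmx_dbl.
- by rewrite !mxE !(inj_eq perm_inj).
- exact: unitmx1.
- by rewrite !mxE (inj_eq perm_inj).
Qed.

Lemma beta_tperm p q i j : j != i -> beta c (tperm p q i) (tperm p q j) = beta c i j.
Proof.
move=> ji; have tji : tperm p q j != tperm p q i by rewrite (inj_eq perm_inj).
rewrite /beta !mxE; congr (_ - _); symmetry; apply: center_conj => [|a b].
- by rewrite unitmx_mul unitmx_shear ?unitmx_dbl.
- by rewrite !mul_mx_diag !mxE !(inj_eq perm_inj).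
- exact: unitmx_shear.
- by rewrite !mxE !(inj_eq perm_inj).
Qed.

Lemma gamma_const : exists g, forall i, gamma c i = g.
Proof.
have [n0|n0] := posnP n; first by exists 0 => i; have := ltn_ord i; rewrite {2}n0.
exists (gamma c (Ordinal n0)) => i.
by rewrite -(gamma_tperm (Ordinal n0) i) tpermR.
Qed.

(** Two transpositions carry one ordered pair to another: the first sends [i0] to [i], the second
    fixes [i] and sends the image of [j0] to [j]. Without distinct indices any value does. *)
Lemma beta_const : exists b, forall i j, j != i -> beta c i j = b.
Proof.
have [/existsP[i0 /existsP[j0 ji0]]|nex] := boolP [exists i : 'I_n, exists j : 'I_n, j != i].
  exists (beta c i0 j0) => i j ji; pose j1 := tperm i0 i j0.
  have j1i : j1 != i by rewrite -[X in _ != X](tpermL i0 i) (inj_eq perm_inj).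
  by rewrite -[RHS](beta_tperm i0 i) // tpermL -[RHS](beta_tperm j1 j) // tpermL tpermD.
exists 0 => i j ji; case/negP: nex.
by apply/existsP; exists i; apply/existsP; exists j.
Qed.

End Constancy.

(** * Centroid and circumcenter relative to a vertex at the origin *)

Definition mean M : 'cV[R]_n := n.+1%:R^-1 *: (M *m const_mx 1).

Lemma meanE M k : mean M k 0 = n.+1%:R^-1 * \sum_l M k l.
Proof. by rewrite mxE [X in _ * X]mxE; under eq_bigr do rewrite mxE mulr1. Qed.

Lemma mean_like : center_like mean 1.
Proof.
split=> [k|Q M _ _|a M _ _|j l M _|j M _].
- exists (fun M => \det M * mean M k 0) => //.
  apply: polyfun_mul; first by apply: polyfun_det => a b; apply: polyfun_entry.
  apply: eq_polyfun (fun M => esym (meanE M k)) _.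
  apply: polyfun_mul; first exact: polyfun_cst.
  by apply: polyfun_sum => l; apply: polyfun_entry.
- by rewrite /mean -mulmxA scalemxAr.
- by rewrite /mean -scalemxAl !scalerA mulrC.
- apply/colP => k; rewrite !meanE; congr (_ * _).
  rewrite [RHS](reindex_inj (@perm_inj _ (tperm j l))) /=.
  by apply: eq_bigr => a _; rewrite mxE.
apply/colP => k; rewrite scale1r meanE [RHS]mxE meanE [in X in _ = _ + X]mxE [in X in _ = _ + X]mxE.
under eq_bigr do rewrite mxE.
(* Column [j] is subtracted once for each of the n columns and once more at [b = j], which cancels
   the denominator of [mean]. *)
have e : \sum_(b < n) (b == j).+1%:R = n.+1%:R :> R.
  under eq_bigr do rewrite -natr1.
  rewrite big_split /= sumr_const card_ord -natr1 addrC; congr (_ + _).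
  by rewrite (bigD1 j) //= eqxx big1 ?addr0 // => b /negPf ->.
by rewrite sumrB -mulr_suml e mulrBr mulKf // pnatr_eq0.
Qed.

Definition sqnorms M : 'cV[R]_n := \col_j (M^T *m M) j j.

(** The point u with 2 <u, v> = <v, v> for every column v, that is, equidistant from the origin and
    the columns. *)
Definition circum M : 'cV[R]_n := 2^-1 *: ((invmx M)^T *m sqnorms M).

Lemma circumP M : M \in unitmx -> M^T *m circum M = 2^-1 *: sqnorms M.
Proof.
by move=> uM; rewrite -scalemxAr mulmxA -trmx_mul mulVmx // trmx1 mul1mx.
Qed.

Lemma circumE M j : M \in unitmx ->
  \sum_a M a j * circum M a 0 = 2^-1 * \sum_a M a j ^+ 2.
Proof.
move=> uM; have /colP/(_ j) := circumP uM; rewrite mxE [RHS]mxE [X in _ * X]mxE.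
under eq_bigr do rewrite mxE.
by move=> ->; rewrite mxE; congr (_ * _); apply: eq_bigr => a _; rewrite mxE expr2.
Qed.

Lemma circum_unique M u : M \in unitmx ->
  M^T *m u = 2^-1 *: sqnorms M -> u = circum M.
Proof.
move=> uM; rewrite -circumP // => /(congr1 (mulmx (invmx M)^T)).
by rewrite !mulmxA -!trmx_mul mulmxV // trmx1 !mul1mx.
Qed.

(** Polynomiality comes from the adjugate; every other condition from uniqueness of the solution of
    the defining linear system. *)
Lemma circum_like : center_like circum 1.
Proof.
have pM (a b : 'I_n) := polyfun_entry R a b.
split=> [k|Q M oQ uM|a M a0 uM|j l M uM|j M uM].
- exists (fun M => 2^-1 * ((\adj M)^T *m sqnorms M) k 0).
    apply: polyfun_mul; first exact: polyfun_cst.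
    apply: polyfun_mulmx => a b.
      apply: (@eq_polyfun _ _ _ _ (fun M => (\adj M) b a)); first by move=> M; rewrite [RHS]mxE.
      exact: polyfun_adj.
    apply: (@eq_polyfun _ _ _ _ (fun M => (M^T *m M) a a)); first by move=> M; rewrite [RHS]mxE.
    apply: polyfun_mulmx => // p q.
    by apply: eq_polyfun (pM q p) => M; rewrite mxE.
  move=> M uM; rewrite /circum /invmx uM linearZ /= -scalemxAl scalerA.
  rewrite [in RHS]mxE [RHS]mulrA; congr (_ * _); rewrite mulrCA mulfV ?mulr1 //.
  by rewrite -unitfE -unitmxE.
- have uQ : Q \in unitmx by case: (mulmx1_unit oQ).
  symmetry; apply: circum_unique; first by rewrite unitmx_mul uQ.
  by rewrite /sqnorms trmx_mul -!mulmxA !(mulmxA Q^T) oQ !mul1mx circumP.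
- symmetry; apply: circum_unique; first by rewrite unitmxZ // unitfE gt_eqF.
  rewrite [(a *: M)^T]linearZ /= -scalemxAl -scalemxAr circumP // /sqnorms.
  rewrite [(a *: M)^T]linearZ /= -scalemxAl -scalemxAr.
  by apply/colP => j; rewrite !mxE; ring.
- symmetry; apply: circum_unique.
    by rewrite xcolE unitmx_mul uM unitmx_perm.
  rewrite xcolE trmx_mul -mulmxA circumP // -scalemxAr; congr (_ *: _).
  rewrite tr_tperm_mx -xrowE; apply/colP => k; rewrite !mxE -xcolE.
  by apply: eq_bigr => a _; rewrite !mxE.
symmetry; apply: circum_unique.
  by rewrite unitmxE det_rebase unitrN -unitmxE.
apply/colP => b; rewrite mxE [RHS]mxE [X in _ * X]mxE [X in _ * X]mxE scale1r.
set r := (b == j).+1%:R : R.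
(* Both sides are expanded into inner products, so that [circumE] eliminates [circum]; [r] is 2 at
   [b = j] and 1 elsewhere. *)
transitivity (\sum_a M a b * circum M a 0 - \sum_a M a b * M a j
    - r * (\sum_a M a j * circum M a 0 - \sum_a M a j ^+ 2)).
  rewrite -!sumrB mulr_sumr -sumrB; apply: eq_bigr => a _.
  by rewrite !mxE -/r; ring.
transitivity (2^-1 * (\sum_a M a b ^+ 2 - 2 * r * \sum_a M a b * M a j
    + r ^+ 2 * \sum_a M a j ^+ 2)); last first.
  congr (_ * _); rewrite !mulr_sumr -sumrB -big_split; apply: eq_bigr => a _.
  by rewrite !mxE -/r /=; ring.
rewrite !circumE // /r; have [->|bj] := eqVneq b j; rewrite /=.
  under [X in _ - X - _]eq_bigr do rewrite -expr2.
  under [X in _ = _ * (_ - _ * X + _)]eq_bigr do rewrite -expr2.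
  by field.
by field.
Qed.

Lemma mean_dbl M i k :
  (mean (M *m diag_mx (dbl R i)) - mean M) k 0 = n.+1%:R^-1 * M k i.
Proof.
rewrite mxE [X in _ + X]mxE !meanE -mulrBr -sumrB; congr (_ * _).
rewrite (bigD1 i) //= mul_mx_diag !mxE eqxx big1 ?addr0; first by ring.
by move=> l /negPf li; rewrite !mxE li mulr1 subrr.
Qed.

Lemma gamma_mean i : gamma mean i = n.+1%:R^-1.
Proof. by rewrite /gamma -[diag_mx _]mul1mx mean_dbl mxE eqxx mulr1. Qed.

Lemma beta_mean i j : j != i -> beta mean i j = n.+1%:R^-1.
Proof.
by move=> ji; rewrite /beta mean_dbl !mxE !eqxx (negPf ji) add0r mulr1.
Qed.

Lemma circum_axis M j a : M \in unitmx -> a != 0 -> col j M = a *: delta_mx j 0 ->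
  circum M j 0 = 2^-1 * a.
Proof.
move=> uM a0 /colP Mj; have ME k : M k j = a * (k == j)%:R.
  by have := Mj k; rewrite !mxE andbT.
have := circumE j uM; rewrite (bigD1 j) //= big1; last first.
  by move=> l /negPf lj; rewrite ME lj mulr0 mul0r.
rewrite (bigD1 j) //= [X in _ = _ * (_ + X)]big1; last first.
  by move=> l /negPf lj; rewrite ME lj mulr0 expr0n.
rewrite ME eqxx mulr1 !addr0 expr2 mulrCA; exact: mulfI.
Qed.

Lemma gamma_circum i : gamma circum i = 2^-1.
Proof.
rewrite /gamma mxE [X in _ + X]mxE (@circum_axis _ _ 2) ?unitmx_dbl ?pnatr_eq0 //.
  rewrite (@circum_axis _ _ 1) ?unitmx1 ?oner_neq0 //; first by field.
  by apply/colP => k; rewrite !mxE mul1r andbT.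
by apply/colP => k; rewrite !mxE andbT mulr_natr; case: eqP.
Qed.

(** Column [j] is [e_j] before and after column [i] is doubled, so both circumcenters have
    coordinate [j] equal to 1/2. *)
Lemma beta_circum i j : j != i -> beta circum i j = 0.
Proof.
move=> ji; rewrite /beta mxE [X in _ + X]mxE.
have us := unitmx_shear ji.
rewrite !(@circum_axis _ _ 1) ?unitmx_mul ?us ?unitmx_dbl ?oner_neq0 ?subrr //.
  by apply/colP => k; rewrite !mxE (negPf ji) mul1r andbT.
by apply/colP => k; rewrite mul_mx_diag !mxE (negPf ji) mul1r mulr1 andbT.
Qed.

Lemma gammaB c c' a i : gamma (fun M => c M - a *: c' M) i = gamma c i - a * gamma c' i.
Proof. by rewrite /gamma !mxE; ring. Qed.

Lemma betaB c c' a i j :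
  beta (fun M => c M - a *: c' M) i j = beta c i j - a * beta c' i j.
Proof. by rewrite /beta !mxE; ring. Qed.

Lemma center_like_combination c : (0 < n)%N -> center_like c 1 ->
  exists t, {in unitmx, forall M, c M = t *: mean M + (1 - t) *: circum M}.
Proof.
move=> n0 cc; have [g gE] := gamma_const cc; have [b bE] := beta_const cc.
(* The solution of t / (n + 1) + s / 2 = g and t / (n + 1) = b, which match [gamma] and [beta]. *)
pose t := n.+1%:R * b; pose s := 2 * (g - b).
have cd := center_likeB s (center_likeB t cc mean_like) circum_like.
have nz : n.+1%:R != 0 :> R by rewrite pnatr_eq0.
have d0 : {in unitmx, forall M, c M - t *: mean M - s *: circum M = 0}.
  apply: (center_like_eq0 cd) => [i|i j ji].
    by rewrite !gammaB gE gamma_mean gamma_circum /t /s mulrAC mulfV //; field.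
  by rewrite !betaB bE // beta_mean // beta_circum // /t mulrAC mulfV // mulr0 mul1r !subrr.
(* The difference is zero on invertible matrices and has weight 1 - t - s; rebasing the identity at
   an existing index forces this weight to be 0. *)
have st : s = 1 - t.
  have := center_rebase cd (Ordinal n0) (unitmx1 R n).
  rewrite !d0 ?unitmx1 ?unitmxE ?det_rebase ?det1 ?unitrN ?unitr1 //.
  move=> /colP/(_ (Ordinal n0)); rewrite !mxE eqxx => h.
  by move: h; rewrite /t /s /=; lra.
exists t => M uM; rewrite -st; apply/eqP; rewrite -subr_eq0 opprD addrA.
by rewrite d0.
Qed.

End CenterLike.

(** * From simplices to matrices and back *)

Section Simplices.
Variables (R : realType) (n : nat).
Implicit Types (M Q : 'M[R]_n) (V : simplex R n) (b : 'cV[R]_n).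

Definition based M : simplex R n := row_mx M 0.

Lemma based_nondegenerate M : M \in unitmx -> nondegenerate_simplex (based M).
Proof.
move=> uM a; rewrite !big_split_ord /= !big_ord1 => a0 aV.
have a_l (j : 'I_n) : a (lshift 1 j) = 0.
  have : M *m (\col_j a (lshift 1 j)) = 0.
    rewrite -[RHS]aV; apply/colP => k; rewrite mxE [RHS]mxE summxE.
    rewrite [X in _ = _ + X]mxE [X in _ = _ + _ * X]mxE /based row_mxEr mxE mulr0 addr0.
    apply: eq_bigr => l _; rewrite /vertex [RHS]mxE [X in _ = _ * X]mxE /based.
    by rewrite row_mxEl mxE mulrC.
  move/(congr1 (mulmx (invmx M))); rewrite mulKmx // mulmx0.
  by move/colP/(_ j); rewrite !mxE.
move: a0; rewrite big1 ?add0r // => a_r j.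
by case: (splitP j) => [l|l] jl; [rewrite -[RHS](a_l l)|rewrite -[RHS]a_r];
  congr a; apply: val_inj; rewrite //= jl ?(ord1 l).
Qed.

Lemma Vol_based M : Vol (based M) = n`!%:R^-1 * \det M.
Proof.
rewrite /Vol /based; congr (_ * _).
rewrite (_ : const_mx 1 = row_mx (const_mx 1) 1%:M); last first.
  apply/rowP => j; rewrite mxE; case: (splitP j) => l jl.
    by rewrite (_ : j = lshift 1 l) ?row_mxEl ?mxE //; apply: val_inj.
  have -> : j = rshift n l by apply: val_inj.
  by rewrite row_mxEr (ord1 l) mxE.
by rewrite -/(block_mx _ _ _ _) det_lblock det1 mulr1.
Qed.

Lemma act_affine (a : R) Q b V :
  act_simplex (fun x => a *: (Q *m x) + b) V = a *: (Q *m V) + b *m const_mx 1.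
Proof.
apply/matrixP => i j; rewrite !mxE big_ord1 !mxE mulr1; congr (_ * _ + _).
by apply: eq_bigr => k _; rewrite mxE.
Qed.

Lemma act_translateE b V i j :
  act_simplex (fun x => 1 *: (1%:M *m x) + b) V i j = V i j + b i 0.
Proof. by rewrite act_affine mul1mx scale1r !mxE big_ord1 !mxE mulr1. Qed.

Lemma affine_similarity (a : R) Q b : 0 < a -> Q^T *m Q = 1%:M ->
  is_similarity (fun x => a *: (Q *m x) + b).
Proof. by move=> a0 oQ; exists a, Q, b. Qed.

(** This is how equivariance under translations and invariance under permutations together yield
    [center_rebase]. *)
Lemma rebase_permute j M :
  permute_simplex (tperm (lshift 1 j) (rshift n 0)) (based (rebase j M)) =
  act_simplex (fun x => 1 *: (1%:M *m x) + - col j M) (based M).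
Proof.
apply/matrixP => a b; rewrite act_translateE mxE [X in _ = _ + X]mxE.
rewrite [X in _ = _ - X]mxE /based.
case: (splitP b) => l bl.
  have -> : b = lshift 1 l by apply: val_inj.
  rewrite row_mxEl; have [->|lj] := eqVneq l j.
    by rewrite tpermL row_mxEr mxE subrr.
  rewrite tpermD ?eq_rlshift ?(inj_eq (@lshift_inj _ _)) //; last by rewrite eq_sym.
  by rewrite row_mxEl mxE (negPf lj) mul1r.
have -> : b = rshift n 0 by rewrite -(ord1 l); apply: val_inj.
by rewrite tpermR row_mxEl row_mxEr !mxE eqxx /=; ring.
Qed.

Lemma based_center_like (C : simplex R n -> 'cV[R]_n) :
  (forall g V, is_similarity g -> nondegenerate_simplex V ->
     C (act_simplex g V) = g (C V)) ->
  (forall s V, nondegenerate_simplex V -> C (permute_simplex s V) = C V) ->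
  polynomial_on_nondegenerate (fun V => Vol V *: C V) ->
  center_like (fun M => C (based M)) 1.
Proof.
move=> Csim Cperm Cpoly; have trivQ : (1%:M)^T *m 1%:M = 1%:M :> 'M[R]_n.
  by rewrite trmx1 mul1mx.
split=> [k|Q M oQ uM|a M a0 uM|j l M uM|j M uM].
- have [p pE] := Cpoly k.
  (* The factorial undoes the normalization of [Vol]. *)
  exists (fun M => n`!%:R * p.@[coords (based M)]); last first.
    move=> M uM; rewrite -pE; last exact: based_nondegenerate.
    by rewrite Vol_based mxE -mulrA mulVKf // pnatr_eq0 -lt0n fact_gt0.
  apply: polyfun_mul; first exact: polyfun_cst.
  apply: (polyfun_meval p (y := fun k M => coords (based M) k)) => m.
  case/mxvec_indexP: m => i j; case: (splitP j) => l jl.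
    apply: (@eq_polyfun _ _ _ _ (fun M => M i l)); last exact: polyfun_entry.
    move=> M; rewrite /coords mxvecE (_ : j = lshift 1 l) ?row_mxEl //.
    exact: val_inj.
  apply: (@eq_polyfun _ _ _ _ (fun=> 0)); last exact: polyfun_cst.
  move=> M; rewrite /coords mxvecE (_ : j = rshift n l) ?row_mxEr ?mxE //.
  exact: val_inj.
- have := Csim _ _ (affine_similarity 0 ltr01 oQ) (based_nondegenerate uM).
  rewrite act_affine mul0mx !addr0 !scale1r => <-.
  by rewrite /based mul_mx_row mulmx0.
- have := Csim _ _ (affine_similarity 0 a0 trivQ) (based_nondegenerate uM).
  rewrite act_affine mul0mx !addr0 !mul1mx => <-.
  by rewrite /based scale_row_mx scaler0.
- rewrite -[RHS](Cperm (tperm (lshift 1 j) (lshift 1 l))); last exact: based_nondegenerate.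
  congr C; apply/matrixP => a b; rewrite [RHS]mxE /based.
  case: (splitP b) => m bm.
    have -> : b = lshift 1 m by apply: val_inj.
    by rewrite row_mxEl mxE -(inj_tperm _ _ _ (@lshift_inj _ _)) row_mxEl.
  have -> : b = rshift n m by apply: val_inj.
  by rewrite tpermD ?eq_lrshift // !row_mxEr !mxE.
have uB : rebase j M \in unitmx by rewrite unitmxE det_rebase unitrN -unitmxE.
have := Csim _ _ (affine_similarity (- col j M) ltr01 trivQ) (based_nondegenerate uM).
rewrite -rebase_permute Cperm; last exact: based_nondegenerate.
by rewrite mul1mx !scale1r.
Qed.

Lemma nondegenerate_based V : nondegenerate_simplex V ->
  exists M b, [/\ M \in unitmx & V = act_simplex (fun x => 1 *: (1%:M *m x) + b) (based M)].
Proof.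
move=> nd; pose b := col (rshift n 0) V.
pose M : 'M[R]_n := lsubmx V - b *m const_mx 1; exists M, b.
have VE : V = act_simplex (fun x => 1 *: (1%:M *m x) + b) (based M).
  apply/matrixP => i j; rewrite act_translateE [X in _ = _ + X]mxE /based.
  case: (splitP j) => l jl.
    have -> : j = lshift 1 l by apply: val_inj.
    by rewrite row_mxEl !mxE big_ord1 !mxE mulr1 subrK.
  have -> : j = rshift n 0 by rewrite -(ord1 l); apply: val_inj.
  by rewrite row_mxEr mxE add0r.
split=> //.
have := aug_unit nd.
(* A translation acts on the augmented matrix by a unipotent block matrix, so invertibility passes
   to the based simplex, whose volume is a nonzero multiple of [\det M]. *)
have -> : col_mx V (const_mx 1) =
    block_mx 1%:M b 0 1%:M *m col_mx (based M) (const_mx 1) :> 'M[R]_(n + 1).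
  rewrite mul_block_col !mul1mx mul0mx add0r {1}VE act_affine.
  by rewrite mul1mx scale1r.
rewrite unitmx_mul => /andP[_]; rewrite !unitmxE !unitfE.
apply: contraNneq => M0; have := Vol_based M; rewrite M0 mulr0 /Vol => /eqP.
by rewrite mulf_eq0 invr_eq0 pnatr_eq0 eqn0Ngt fact_gt0 => /= /eqP ->.
Qed.

Lemma CM_based M b :
  CM (act_simplex (fun x => 1 *: (1%:M *m x) + b) (based M)) = mean M + b.
Proof.
rewrite /CM; apply/colP => k.
rewrite mxE summxE [RHS]mxE meanE big_split_ord /= big_ord1 addn1.
under eq_bigr do rewrite mxE act_translateE row_mxEl.
rewrite mxE act_translateE row_mxEr mxE add0r big_split /= sumr_const card_ord.
by rewrite -mulr_natr -natr1; field; rewrite natr1 pnatr_eq0.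
Qed.

Lemma equidistant_based M b : M \in unitmx ->
  equidistant (act_simplex (fun x => 1 *: (1%:M *m x) + b) (based M)) (circum M + b).
Proof.
move=> uM; set V := act_simplex _ _.
suff h j : \sum_k ((circum M + b) k 0 - vertex V j k 0) ^+ 2 = \sum_k circum M k 0 ^+ 2.
  by move=> i j; rewrite /dist !h.
have VE k : (circum M + b) k 0 - vertex V j k 0 = circum M k 0 - based M k j.
  by rewrite mxE [vertex _ _ _ _]mxE act_translateE; ring.
under eq_bigr do rewrite VE.
rewrite /based; case: (splitP j) => l jl.
  have -> : j = lshift 1 l by apply: val_inj.
  have := circumE l uM => e.
  transitivity (\sum_k circum M k 0 ^+ 2 - 2 * \sum_k M k l * circum M k 0
     + \sum_k M k l ^+ 2); last by rewrite e; field.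
  rewrite mulr_sumr -sumrB -big_split; apply: eq_bigr => k _ /=.
  by rewrite row_mxEl; ring.
have -> : j = rshift n l by apply: val_inj.
by apply: eq_bigr => k _; rewrite row_mxEr [X in _ - X]mxE subr0.
Qed.

End Simplices.

Theorem theorem1 (R : realType) (n : nat) (hn : (1 <= n)%N)
  (C : simplex R n -> 'cV[R]_n)
  (C_similarity : forall (g : 'cV[R]_n -> 'cV[R]_n) (V : simplex R n),
     is_similarity g -> nondegenerate_simplex V -> C (act_simplex g V) = g (C V))
  (C_permutation : forall (s : 'S_(n + 1)) (V : simplex R n),
     nondegenerate_simplex V -> C (permute_simplex s V) = C V)
  (C_polynomial : polynomial_on_nondegenerate (fun V => Vol V *: C V)) :
  exists t : R, forall V : simplex R n, nondegenerate_simplex V ->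
    C V = t *: CM V + (1 - t) *: CC V.
Proof.
have cC := based_center_like C_similarity C_permutation C_polynomial.
have [t tE] := center_like_combination hn cC.
exists t => V ndV; have [M [b [uM VE]]] := nondegenerate_based ndV.
(* Nondegeneracy rules out the default value of [CC], and makes the equidistant point unique. *)
have -> : CC V = circum M + b.
  apply: (equidistant_unique ndV); first exact: equidistant_CC.
  by rewrite VE; apply: equidistant_based.
have oI : (1%:M)^T *m 1%:M = 1%:M :> 'M[R]_n by rewrite trmx1 mul1mx.
have nM := based_nondegenerate uM.
rewrite {1}VE (C_similarity _ _ (affine_similarity b ltr01 oI) nM) {1}VE CM_based.
rewrite tE // mul1mx scale1r; apply/colP => k; rewrite !mxE; ring.
Qed.
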